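(* Let $A$ be a Banach algebra and let $P$ be a left Banach $A$-module. The following properties are equivalent: (i) $P$ is projective. (ii) The topology on $\operatorname{Ext}^1_A(P,X)$ is trivial for each left Banach $A$-module $X$. (iii) For all left Banach $A$-modules $X,Y$, each admissible epimorphism $\sigma\colon X\to Y$ and each morphism $\varphi\colon P\to Y$ of left Banach $A$-modules, there exists a net $\{\varphi_\nu\}$ in ${}_A\mathbf h(P,X)$ such that $\sigma\varphi_\nu\to\varphi$ in the norm topology. (Equivalently, for each admissible epimorphism $X\to Y$ of left Banach $A$-modules the induced map ${}_A\mathbf h(P,X)\to{}_A\mathbf h(P,Y)$ has dense range.) (iv) For all $X,Y,\sigma,\varphi$ as described in (iii), there exists a uniform approximate morphism $\{\psi_\nu\}$ in $\mathscr B(P,X)$ such that $\sigma\psi_\nu=\varphi$ for all $\nu$. (v) For all $X,Y,\sigma,\varphi$ as described in (iii), there exists a uniform approximate morphism $\{\psi_\nu\}$ in $\mathscr B(P,X)$ such that $\sigma\psi_\nu\to\varphi$ in the norm topology. (vi) There exist a projective left Banach $A$-module $F$, an admissible epimorphism $\pi\colon F\to P$ and a uniform approximate morphism $\{\rho_\nu\}$ in $\mathscr B(P,F)$ such that $\pi\rho_\nu\to\mathbf 1_P$ in the norm topology. (vii) For each left Banach $A$-module $X$ and each $f\in Z^1(A\times P,X)$, there exists a net $\{T_\nu\}$ in $\mathscr B(P,X)$ such that $\delta^0T_\nu\to f$ in the norm topology.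
   Context: Banach algebras are not assumed unital. A left Banach $A$-module is a Banach space with a jointly continuous bilinear associative left action of $A$; morphisms are bounded linear $A$-module maps. $\mathscr B(X,Y)$ is the Banach space of bounded linear operators $X\to Y$, and ${}_A\mathbf h(X,Y)\subset\mathscr B(X,Y)$ is the closed subspace of left $A$-module morphisms. $\mathbf 1_P$ is the identity operator. A chain complex of Banach modules is admissible if it splits as a complex of Banach spaces. A morphism is an admissible epimorphism if it fits as the map $Y\to Z$ into a short admissible sequence $0\to X\to Y\to Z\to0$ of modules, i.e. it is surjective and has a bounded linear right inverse. $P$ is projective if for each admissible epimorphism $X\to Y$ of left Banach $A$-modules the induced map ${}_A\mathbf h(P,X)\to{}_A\mathbf h(P,Y)$ is onto. A projective resolution of $X$ is a chain complex $P_\bullet=(P_n,d_n)_{n\ge0}$ of projective modules with a morphism $P_0\to X$ such that the augmented sequence $P_\bullet\to X\to0$ is admissible. $\operatorname{Ext}^n_A(X,Y)$ is the $n$th cohomology of the complex ${}_A\mathbf h(P_\bullet,Y)$, seminormed by the quotient seminorm (cocycles modulo coboundaries); its topology does not depend on the choice of resolution. The topology is trivial if it is indiscrete, i.e. the coboundaries are dense in the cocycles. $Z^1(A\times X,Y)$ is the Banach space of continuous bilinear maps $f\colon A\times X\to Y$ with $a\cdot f(b,x)-f(ab,x)+f(a,b\cdot x)=0$ for all $a,b\in A$, $x\in X$. The map $\delta^0\colon\mathscr B(X,Y)\to Z^1(A\times X,Y)$ is $(\delta^0T)(a,x)=a\cdot T(x)-T(a\cdot x)$. One has topologically $\operatorname{Ext}^1_A(X,Y)=Z^1(A\times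 X,Y)/\operatorname{Im}\delta^0$. A uniform approximate morphism from $X$ to $Y$ is a net $\{\varphi_\nu\}$ in $\mathscr B(X,Y)$ such that $\varphi_\nu(a\cdot x)-a\cdot\varphi_\nu(x)\to0$ uniformly on bounded subsets of $A$ and $X$ (i.e. uniformly for $a,x$ ranging over bounded sets). *)

(* Defs.v *)
From HB Require Import structures.
From mathcomp Require Import all_boot all_order all_algebra complex.
From mathcomp Require Import all_classical all_reals all_analysis.
Import Order.TTheory GRing.Theory Num.Theory.
Import numFieldNormedType.Exports.

Set Implicit Arguments.
Unset Strict Implicit.

Local Open Scope classical_set_scope.
Local Open Scope ring_scope.
Local Open Scope complex_scope.

(* No unit is assumed, so the ring structures of MathComp do not apply. *)
HB.mixin Record isBanachAlgebra (R : realType) A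
    of CompleteNormedModule R[i] A := {
  bmul : A -> A -> A ;
  bmulA : associative bmul ;
  bmul_linearl : forall b, linear (bmul ^~ b) ;
  bmul_linearr : forall a, linear (bmul a) ;
  ler_norm_bmul : forall a b, `|bmul a b| <= `|a| * `|b|
}.

#[short(type="banachAlgType")]
HB.structure Definition BanachAlgebra (R : realType) :=
  {A of isBanachAlgebra R A & CompleteNormedModule R[i] A}.

HB.mixin Record isBanachModule (R : realType) (A : banachAlgType R) X
    of CompleteNormedModule R[i] X := {
  bact : A -> X -> X ;
  bactA : forall a b x, bact a (bact b x) = bact (bmul a b) x ;
  bact_linearl : forall x, linear (bact ^~ x) ;
  bact_linearr : forall a, linear (bact a) ;
  bact_continuous : continuous (fun z : A * X => bact z.1 z.2)
}.

#[short(type="banachModType")]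
HB.structure Definition BanachModule (R : realType) (A : banachAlgType R) :=
  {X of isBanachModule R A X & CompleteNormedModule R[i] X}.

Unset Implicit Arguments.

Definition bounded_op {R : realType} (X Y : completeNormedModType R[i]) :
    set (X -> Y) :=
  [set T | linear T /\ exists M : R[i], forall x, `|T x| <= M * `|x|].

(* The norms of MathComp-Analysis take their values in the scalar field R[i];
   Re brings these nonnegative numbers back to R.  For T in bounded_op X Y this
   is the operator norm.  The norm of a product is the maximum of the norms, so
   for a continuous bilinear f : A * X -> Y this is the supremum of the norm of
   f (a, x) over |a| <= 1 and |x| <= 1. *)
Definition op_norm {R : realType} {X Y : normedModType R[i]} (T : X -> Y) : R :=
  sup [set complex.Re `|T x| | x in [set x | `|x| <= 1]].

Definition norm_closure {R : realType} {X Y : normedModType R[i]}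
    (S : set (X -> Y)) : set (X -> Y) :=
  [set T | forall e : R, 0 < e -> exists2 T', S T' & op_norm (T \- T') < e].

Record directedType := DirectedType {
  dir_disp : Order.disp_t ;
  dir_sort :> preorderType dir_disp ;
  dir_inhabited : inhabited dir_sort ;
  dir_directed : forall i j : dir_sort, exists k, (i <= k)%O /\ (j <= k)%O
}.

Definition tails (I : directedType) : set_system I :=
  filter_from setT (fun i => [set j | (i <= j)%O]).

Global Instance tails_proper (I : directedType) : ProperFilter (tails I).
Proof.
apply: filter_from_proper; last by move=> i _; exists i => /=.
apply: filter_from_filter; first by case: (dir_inhabited I) => i; exists i.
move=> i j _ _; have [k [ik jk]] := dir_directed I i j.
by exists k => // l /= kl; split; apply: le_trans kl.
Qed.

Definition norm_cvg {R : realType} {I : directedType}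
    {X Y : normedModType R[i]} (T_ : I -> X -> Y) (T : X -> Y) : Prop :=
  op_norm (T_ i \- T) @[i --> tails I] --> (0 : R).

Section Projectivity.
Context {R : realType} {A : banachAlgType R}.

Definition module_hom (X Y : banachModType A) : set (X -> Y) :=
  [set T | bounded_op X Y T /\ forall a x, T (bact a x) = bact a (T x)].

Definition admissible_epi {X Y : banachModType A} (s : X -> Y) : Prop :=
  module_hom X Y s /\ exists2 t, bounded_op Y X t & s \o t = id.

Definition projective (P : banachModType A) : Prop :=
  forall (X Y : banachModType A) (s : X -> Y) (phi : P -> Y),
    admissible_epi s -> module_hom P Y phi ->
    exists2 psi, module_hom P X psi & s \o psi = phi.

(* res_d n is the differential P_(n+1) -> P_n.  Admissibility of the augmented
   complex ... -> P_1 -> P_0 -> X -> 0, i.e. its splitting as a complex of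
   Banach spaces, is the existence of a contracting homotopy made of bounded
   linear operators. *)
Record projective_resolution (X : banachModType A) := ProjectiveResolution {
  res_obj : nat -> banachModType A ;
  res_d : forall n, res_obj n.+1 -> res_obj n ;
  res_aug : res_obj 0 -> X ;
  res_projective : forall n, projective (res_obj n) ;
  res_d_hom : forall n, module_hom (res_obj n.+1) (res_obj n) (res_d n) ;
  res_aug_hom : module_hom (res_obj 0) X res_aug ;
  res_dd : forall n x, res_d n (res_d n.+1 x) = 0 ;
  res_augd : forall x, res_aug (res_d 0 x) = 0 ;
  res_admissible :
    exists (t : X -> res_obj 0) (h : forall n, res_obj n -> res_obj n.+1),
      [/\ bounded_op X (res_obj 0) t,
          forall n, bounded_op (res_obj n) (res_obj n.+1) (h n),
          forall x, res_aug (t x) = x,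
          forall x, t (res_aug x) + res_d 0 (h 0 x) = x &
          forall n x, h n (res_d n x) + res_d n.+1 (h n.+1 x) = x]
}.

End Projectivity.

Arguments res_obj {R A X} _ n.
Arguments res_d {R A X} _ n _.
Arguments res_aug {R A X} _ _.

Section Cohomology.
Context {R : realType} {A : banachAlgType R}.

Definition cocycles {X : banachModType A} (Q : projective_resolution X)
    (Y : banachModType A) (n : nat) : set (res_obj Q n -> Y) :=
  [set f | module_hom (res_obj Q n) Y f /\ f \o res_d Q n = fun=> 0].

Definition coboundaries {X : banachModType A} (Q : projective_resolution X)
    (Y : banachModType A) (n : nat) : set (res_obj Q n -> Y) :=
  match n with
  | 0 => [set (fun=> 0)]
  | m.+1 => [set g \o res_d Q m | g in module_hom (res_obj Q m) Y]
  end.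

(* The topology of Ext^n_A(X, Y) does not depend on the projective resolution
   from which it is computed; all of them are considered. *)
Definition Ext_topology_trivial (n : nat) (X Y : banachModType A) : Prop :=
  forall Q : projective_resolution X,
    cocycles Q Y n `<=` norm_closure (coboundaries Q Y n).

Definition Z1 (X Y : banachModType A) : set (A * X -> Y) :=
  [set f | [/\ continuous f,
               forall x : X, linear (fun a => f (a, x)),
               forall a : A, linear (fun x => f (a, x)) &
               forall (a b : A) (x : X),
                 bact a (f (b, x)) - f (bmul a b, x) + f (a, bact b x) = 0]].

Definition delta0 {X Y : banachModType A} (T : X -> Y) : A * X -> Y :=
  fun z => bact z.1 (T z.2) - T (bact z.1 z.2).

Definition uniform_approximate_morphism {I : directedType}
    {X Y : banachModType A} (phi_ : I -> X -> Y) : Prop :=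
  (forall i, bounded_op X Y (phi_ i)) /\
  forall (S : set A) (B : set X), bounded_set S -> bounded_set B ->
    {uniform S `*` B,
      (fun i (z : A * X) => phi_ i (bact z.1 z.2) - bact z.1 (phi_ i z.2))
        @ tails I --> (fun=> 0 : Y)}.

End Cohomology.

(* Main.v *)
Require Import Defs.
From HB Require Import structures.
From mathcomp Require Import all_boot all_order all_algebra complex.
From mathcomp Require Import all_classical all_reals all_analysis.
From mathcomp Require Import lra ring.

Set Implicit Arguments.
Unset Strict Implicit.
Unset Printing Implicit Defensive.

Import Order.TTheory GRing.Theory Num.Theory.
Import numFieldNormedType.Exports.

Local Open Scope classical_set_scope.
Local Open Scope ring_scope.
Local Open Scope complex_scope.

(** Write F for the free module A_+ ⊗ P, where A_+ is the algebra with a unit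
    adjoined and ⊗ is the completed projective tensor product, e : F -> P for
    the canonical admissible epimorphism (1 ⊗ p is sent to p), and K for its
    kernel.  P is projective as soon as it is a retract of F, that is, as soon
    as some morphism F -> K restricts to the identity of K.  What makes all the
    approximate conditions exact is that it suffices to find a morphism
    g : F -> K whose restriction to K is at distance at most 1/2 of the
    identity: this restriction is then invertible by the Neumann series, and
    composing g with its inverse gives the retraction
    (near_retraction_projective).

    Both density conditions provide such a g when the coefficients are K.
    - For Ext, take the bar resolution, whose modules are the free modules over
      P, over F and so on.  Its first differential d is a cocycle with values
      in K, and a coboundary g d close to it means that g is close to the
      identity on K, since every k in K is d (1 ⊗ k)
      (Ext_trivial_projective).
    - For Z^1, the cocycle a ⊗ p - 1 ⊗ ap takes values in K.  If delta^0 T is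
      close to it, the morphism g : F -> K extending T works: the difference
      between u - 1 ⊗ e(u) and its image under g vanishes at the 1 ⊗ p and is
      small at the a ⊗ p, hence small on F by the universal property of the
      tensor product, and on K it is the difference between the identity and g
      (Z1_approx_projective).

    The other implications are direct.  A projective P lifts the identity
    through the augmentation of any resolution, which splits off the cocycles
    (projective_Ext_trivial).  An approximate lifting of phi by morphisms
    becomes an exact lifting by approximate morphisms once the error is
    corrected with a bounded linear section (dense_lift_approximate).  Every
    cocycle on a projective module is a coboundary (projective_Z1); pulling
    back a cocycle of P to a projective F and composing with approximate
    sections rho_i of F -> P approximates it by coboundaries
    (approximate_section_Z1).

    The space underlying F is a completion of the formal sums of symbols 1 ⊗ x
    and a ⊗ x, for the largest seminorm that makes contractive every pair of
    a linear map on P and a bilinear map on A * P that are contractive into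
    some Banach space.  Letting the target range over all Banach spaces makes
    the universal property (free_lift) immediate, and the density of the formal
    sums gives the uniqueness (free_op_uniq). *)

(** * Linear maps and real norms *)

Section LinearMaps.
Context {K : pzRingType} {X Y : lmodType K} {T : X -> Y}.
Hypothesis lT : linear T.

Lemma lin0 : T 0 = 0.
Proof.
by have := lT (-1) 0 0; rewrite scaler0 addr0 scaleN1r addNr.
Qed.

Lemma linD x y : T (x + y) = T x + T y.
Proof. by have := lT 1 x y; rewrite !scale1r. Qed.

Lemma linZ c x : T (c *: x) = c *: T x.
Proof. by have := lT c x 0; rewrite !addr0 lin0 addr0. Qed.

Lemma linN x : T (- x) = - T x.
Proof. by rewrite -scaleN1r linZ scaleN1r. Qed.

Lemma linB x y : T (x - y) = T x - T y.
Proof. by rewrite linD linN. Qed.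
End LinearMaps.

Lemma linear_sub {K : pzRingType} {X Y : lmodType K} (S T : X -> Y) :
  linear S -> linear T -> linear (fun x => S x - T x).
Proof. by move=> lS lT c x y; rewrite lS lT scalerBr opprD addrACA. Qed.

(** The cancellation behind the cocycle identity for a ⊗ x - 1 ⊗ ax. *)
Lemma sub_sub_add_sub {V : zmodType} (u v w : V) : u - v - (u - w) + (v - w) = 0.
Proof. by rewrite opprB [X in X + _]addrC subrKA -[v - w]opprB subrr. Qed.

Section Nrm.
Context {R : realType}.
Implicit Types X Y : normedModType R[i].

(** The norms of Banach spaces over R[i] are nonnegative complex numbers; all
    estimates are made on the corresponding real numbers, which are totally
    ordered. *)
Definition nrm {X : normedModType R[i]} (x : X) : R := complex.Re `|x|.

Definition cabs (c : R[i]) : R := complex.Re `|c|.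

Lemma nrmE {X} (x : X) : `|x| = (nrm x)%:C.
Proof.
by rewrite /nrm; have := normr_ge0 x; case: `|x| => a b; rewrite lecE /= =>
  /andP[/eqP -> _].
Qed.

Lemma cabsE (c : R[i]) : `|c| = (cabs c)%:C.
Proof.
by rewrite /cabs; have := normr_ge0 c; case: `|c| => a b; rewrite lecE /= =>
  /andP[/eqP -> _].
Qed.

Lemma nrm_ge0 {X} (x : X) : 0 <= nrm x.
Proof. by rewrite -ler0c -nrmE. Qed.

Lemma cabs_ge0 c : 0 <= cabs c.
Proof. by rewrite -ler0c -cabsE. Qed.

Lemma cabsR (r : R) : cabs r%:C = `|r|.
Proof.
apply: complexI; rewrite -cabsE normc_def /=.
by rewrite expr0n addr0 sqrtr_sqr.
Qed.

Lemma nrmD {X} (x y : X) : nrm (x + y) <= nrm x + nrm y.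
Proof. by have := ler_normD x y; rewrite !nrmE -rmorphD lecR. Qed.

Lemma nrmZ {X} c (x : X) : nrm (c *: x) = cabs c * nrm x.
Proof. by have := normrZ c x; rewrite nrmE (nrmE x) cabsE -rmorphM => /complexI. Qed.

Lemma nrmZr {X} (r : R) (x : X) : nrm (r%:C *: x) = `|r| * nrm x.
Proof. by rewrite nrmZ cabsR. Qed.

Lemma nrmN {X} (x : X) : nrm (- x) = nrm x.
Proof. by rewrite /nrm normrN. Qed.

Lemma nrmC {X} (x y : X) : nrm (x - y) = nrm (y - x).
Proof. by rewrite -nrmN opprB. Qed.

Lemma nrmB {X} (x y : X) : nrm (x - y) <= nrm x + nrm y.
Proof. by rewrite -(nrmN y); exact: nrmD. Qed.

Lemma nrmT {X} (y x z : X) : nrm (x - z) <= nrm (x - y) + nrm (y - z).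
Proof. by rewrite -[x in nrm (x - z)](subrK y) -addrA; exact: nrmD. Qed.

Lemma nrm0 {X} : nrm (0 : X) = 0.
Proof. by rewrite /nrm normr0. Qed.

Lemma nrm_le_sub {X} (x y : X) : nrm x <= nrm (x - y) + nrm y.
Proof. by rewrite -[x in nrm x](subrK y); exact: nrmD. Qed.

Lemma nrm0_eq0 {X} (x : X) : nrm x = 0 -> x = 0.
Proof. by move=> x0; apply/normr0_eq0; rewrite nrmE x0. Qed.

Lemma nrm_small {X} (x : X) (C : R) :
  (forall e : R, 0 < e -> nrm x <= C * e) -> x = 0.
Proof.
move=> h; apply: nrm0_eq0; apply/eqP; rewrite eq_le nrm_ge0 andbT.
apply/ler_addgt0Pl => e e0; rewrite addr0.
have C1 : 0 < `|C| + 1 by rewrite ltr_pwDr.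
apply: (le_trans (h (e / (`|C| + 1)) (divr_gt0 e0 C1))).
rewrite mulrCA; apply: ler_piMr; first exact: ltW.
rewrite ler_pdivrMr // mul1r.
by rewrite (le_trans (ler_norm C)) // lerDl.
Qed.

Lemma ltr_nrm {X} (x : X) (e : R) : (`|x| < e%:C) = (nrm x < e).
Proof. by rewrite nrmE ltcR. Qed.

Lemma ler_nrm {X} (x : X) (e : R) : (`|x| <= e%:C) = (nrm x <= e).
Proof. by rewrite nrmE lecR. Qed.

Lemma gt0_real (e : R[i]) : 0 < e -> exists2 r : R, 0 < r & e = r%:C.
Proof.
by case: e => a b; rewrite ltcE /= => /andP[/eqP -> a0]; exists a.
Qed.
End Nrm.

(** * Sequences *)

Section Sequences.
Context {R : realType}.

Lemma archi_ex (x : R) : exists N : nat, x <= N%:R.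
Proof.
exists (Num.bound `|x|); rewrite (le_trans (ler_norm x))// ltW//.
exact: archi_boundP.
Qed.

Lemma inv_nat_small (e : R) : 0 < e ->
  exists N, forall n, (N <= n)%N -> n.+1%:R^-1 <= e.
Proof.
move=> e0; have [N hN] := archi_ex e^-1; exists N => n Nn.
rewrite -[e]invrK lef_pV2 ?posrE// ?invr_gt0//.
by rewrite (le_trans hN)// ler_nat leqW.
Qed.

Definition cauchy_seq {X : normedModType R[i]} (u : nat -> X) :=
  forall e : R, 0 < e -> exists N : nat, forall m n,
    (N <= m)%N -> (N <= n)%N -> nrm (u m - u n) <= e.

Definition cvg_seq {X : normedModType R[i]} (u : nat -> X) (x : X) :=
  forall e : R, 0 < e -> exists N : nat, forall n,
    (N <= n)%N -> nrm (u n - x) <= e.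

Lemma cauchy_cvg_seq {X : completeNormedModType R[i]} (u : nat -> X) :
  cauchy_seq u -> exists x, cvg_seq u x.
Proof.
move=> cu.
have : cvg (u @ \oo).
  apply: cauchy_cvg; apply/cauchy_exP => e /gt0_real[r r0 ->].
  have [|N hN] := cu (r / 2); first by rewrite divr_gt0.
  exists (u N); exists N => // n /= Nn.
  rewrite -ball_normE /= ltr_nrm (le_lt_trans (hN _ _ _ _))//.
  by rewrite ltr_pdivrMr // mulr_natr mulr2n ltrDl.
move=> /cvg_ex[x /cvgrPdist_le ux]; exists x => e e0.
have [|N _ hN] := ux e%:C; first by rewrite ltcR.
by exists N => n Nn; have := hN n Nn; rewrite ler_nrm nrmC.
Qed.

Section Limits.
Context {X Y : normedModType R[i]}.

Lemma cvg_seq_uniq (u : nat -> X) x y : cvg_seq u x -> cvg_seq u y -> x = y.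
Proof.
move=> ux uy; apply/eqP; rewrite -subr_eq0; apply/eqP.
apply: (@nrm_small _ _ _ 2) => e e0; have [N hN] := ux e e0.
have [M hM] := uy e e0.
apply: (le_trans (nrmT (u (N + M)%N) _ _)); rewrite mulr_natl mulr2n.
by rewrite lerD //; [rewrite nrmC hN // leq_addr|rewrite hM // leq_addl].
Qed.

Lemma cvg_seqD (u v : nat -> X) x y : cvg_seq u x -> cvg_seq v y ->
  cvg_seq (fun n => u n + v n) (x + y).
Proof.
move=> ux vy e e0; have e2 : 0 < e / 2 by rewrite divr_gt0.
have [N hN] := ux _ e2; have [M hM] := vy _ e2.
exists (N + M)%N => n Nn; rewrite opprD addrACA (le_trans (nrmD _ _))//.
rewrite [leRHS](splitr e) lerD//; [apply: hN|apply: hM].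
  exact: leq_trans (leq_addr _ _) Nn.
exact: leq_trans (leq_addl _ _) Nn.
Qed.

Lemma cvg_seq_cst (x : X) : cvg_seq (fun=> x) x.
Proof. by move=> e e0; exists 0%N => n _; rewrite subrr nrm0 ltW. Qed.

Lemma cvg_seq_bdd (T : X -> Y) (M : R) (u : nat -> X) x : linear T ->
  (forall x, nrm (T x) <= M * nrm x) -> cvg_seq u x -> cvg_seq (T \o u) (T x).
Proof.
move=> lT bT ux e e0.
have M1 : 0 < `|M| + 1 by rewrite ltr_pwDr.
have [|N hN] := ux (e / (`|M| + 1)); first by rewrite divr_gt0.
exists N => n Nn; rewrite /= -(linB lT) (le_trans (bT _))//.
rewrite (@le_trans _ _ ((`|M| + 1) * nrm (u n - x)))//.
  by rewrite ler_wpM2r ?nrm_ge0// (le_trans (ler_norm _))// lerDl.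
by rewrite mulrC -ler_pdivlMr// hN.
Qed.

Lemma cvg_seqZ c (u : nat -> X) x : cvg_seq u x ->
  cvg_seq (fun n => c *: u n) (c *: x).
Proof.
move=> ux e e0.
have M1 : 0 < cabs c + 1 by rewrite ltr_pwDr// cabs_ge0.
have [|N hN] := ux (e / (cabs c + 1)); first by rewrite divr_gt0.
exists N => n Nn; rewrite -scalerBr nrmZ.
rewrite (@le_trans _ _ ((cabs c + 1) * nrm (u n - x)))//.
  by rewrite ler_wpM2r ?nrm_ge0// lerDl.
by rewrite mulrC -ler_pdivlMr// hN.
Qed.

Lemma cvg_seq_le (u : nat -> X) x y (r : R) : cvg_seq u x ->
  (exists N, forall n, (N <= n)%N -> nrm (u n - y) <= r) -> nrm (x - y) <= r.
Proof.
move=> ux [N hN]; apply/ler_addgt0Pl => e e0; have [M hM] := ux e e0.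
rewrite (le_trans (nrmT (u (N + M)%N) _ _))// nrmC lerD//.
  by rewrite hM// leq_addl.
by rewrite hN// leq_addr.
Qed.
End Limits.

(** A Cauchy filter is followed by a Cauchy sequence, chosen in balls of radius
    1 / (n + 1) that belong to the filter; this reduces the completeness of the
    spaces constructed below to that of sequences. *)
Lemma seq_complete (X : normedModType R[i]) :
  (forall u : nat -> X, cauchy_seq u -> exists x, cvg_seq u x) ->
  forall F : set_system X, ProperFilter F -> cauchy F -> cvg F.
Proof.
move=> cX F FF /cauchyP cF.
pose r (n : nat) : R := n.+1%:R^-1.
have r0 n : 0 < r n by rewrite invr_gt0.
have /choice[u hu] n : exists x, F (ball x (r n)%:C).
  by have [|x ?] := cF (r n)%:C; [rewrite ltcR|exists x].
have uF n m : nrm (u n - u m) <= r n + r m.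
  have [z [/= ]] := filter_ex (filterI (hu n) (hu m)).
  rewrite -!ball_normE /= !ltr_nrm => uz mz.
  by rewrite (le_trans (nrmT z _ _))// (nrmC z) lerD// ltW.
have [|x ux] := cX u.
  move=> e e0; have [|N hN] := inv_nat_small (e := e / 2); first by rewrite divr_gt0.
  exists N => m n Nm Nn; rewrite (le_trans (uF _ _))// [leRHS]splitr.
  by rewrite lerD// hN.
apply/cvg_ex; exists x; apply/cvgrPdist_lt => e /gt0_real[s s0 ->].
have s3 : 0 < s / 3 by rewrite divr_gt0.
have [N hN] := ux _ s3; have [M hM] := inv_nat_small s3.
near=> y; rewrite ltr_nrm.
rewrite (le_lt_trans (nrmT (u (N + M)%N) _ _))//.
have -> : s = s / 3 + (s / 3 + s / 3) by field.
rewrite ler_ltD//; first by rewrite nrmC hN// leq_addr.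
have h : nrm (u (N + M)%N - y) < r (N + M)%N.
  by rewrite -ltr_nrm; near: y; have := hu (N + M)%N; rewrite -ball_normE.
by rewrite (lt_le_trans h)// (le_trans (hM _ (leq_addl _ _)))// lerDl ltW.
Unshelve. all: by end_near. Qed.

End Sequences.

(** * Bounded operators and bilinear maps *)

Section Bounded.
Context {R : realType}.

(** A bound M in R[i] can be replaced by its modulus: M * `|x| is a nonnegative
    real number as soon as it bounds a norm. *)
Lemma bounded_opP (X Y : completeNormedModType R[i]) (T : X -> Y) :
  bounded_op X Y T <->
  linear T /\ exists2 M : R, 0 <= M & forall x, nrm (T x) <= M * nrm x.
Proof.
split=> -[lT [M]] => [hM|M0 hM]; split=> //; last first.
  by exists M%:C => x; rewrite !nrmE -rmorphM lecR.
exists (cabs M) => [|x]; first exact: cabs_ge0.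
have Mx : M * `|x| = (cabs M)%:C * (nrm x)%:C.
  by rewrite -cabsE -(nrmE x) -[in RHS]normr_id -normrM ger0_norm//
    (le_trans _ (hM x)).
by have := hM x; rewrite Mx nrmE -rmorphM lecR.
Qed.

Section Composition.
Context {X Y Z : completeNormedModType R[i]}.

Lemma bounded_opD (S T : X -> Y) : bounded_op X Y S -> bounded_op X Y T ->
  bounded_op X Y (fun x => S x + T x).
Proof.
move=> /bounded_opP[lS [M M0 hS]] /bounded_opP[lT [N N0 hT]].
apply/bounded_opP; split=> [c x y|].
  by rewrite lS lT scalerDr addrACA.
exists (M + N) => [|x]; first by rewrite addr_ge0.
by rewrite (le_trans (nrmD _ _))// mulrDl lerD.
Qed.

Lemma bounded_opN (S : X -> Y) : bounded_op X Y S ->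
  bounded_op X Y (fun x => - S x).
Proof.
move=> /bounded_opP[lS [M M0 hS]]; apply/bounded_opP; split=> [c x y|].
  by rewrite lS opprD scalerN.
by exists M => // x; rewrite nrmN.
Qed.

Lemma bounded_op_comp (S : Y -> Z) (T : X -> Y) :
  bounded_op Y Z S -> bounded_op X Y T -> bounded_op X Z (S \o T).
Proof.
move=> /bounded_opP[lS [M M0 hS]] /bounded_opP[lT [N N0 hT]].
apply/bounded_opP; split=> [c x y|]; first by rewrite /= lT lS.
exists (M * N) => [|x /=]; first exact: mulr_ge0.
by rewrite (le_trans (hS _))// -mulrA ler_wpM2l.
Qed.

Lemma bounded_op_id : bounded_op X X id.
Proof.
by apply/bounded_opP; split=> // ; exists 1 => // x; rewrite mul1r.
Qed.
End Composition.

Lemma bounded_opB (X Y : completeNormedModType R[i]) (S T : X -> Y) :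
  bounded_op X Y S -> bounded_op X Y T -> bounded_op X Y (fun x => S x - T x).
Proof. by move=> bS bT; apply: bounded_opD => //; exact: bounded_opN. Qed.

Section OpNorm.
Context {X Y : normedModType R[i]}.

Lemma op_norm_le (T : X -> Y) (e : R) : 0 <= e ->
  (forall x, nrm x <= 1 -> nrm (T x) <= e) -> op_norm T <= e.
Proof.
move=> e0 hT; rewrite /op_norm; set S := (X in sup X).
have [->|/set0P S0] := eqVneq S set0; first by rewrite sup0.
apply: ge_sup => // _ [x /= x1 <-]; apply: hT.
by rewrite -lecR -nrmE.
Qed.

(** A bound on the unit ball has to be assumed, the supremum of an unbounded
    set being 0. *)
Lemma op_norm_ge (T : X -> Y) (M : R) (x : X) :
  (forall x, nrm x <= 1 -> nrm (T x) <= M) -> nrm x <= 1 ->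
  nrm (T x) <= op_norm T.
Proof.
move=> hT x1; apply: ub_le_sup; last first.
  by exists x => //=; rewrite nrmE lecR.
exists M => _ [y /= y1 <-]; apply: hT.
by rewrite -lecR -nrmE.
Qed.

Lemma op_norm_ge0 (T : X -> Y) (M : R) :
  (forall x, nrm x <= 1 -> nrm (T x) <= M) -> 0 <= op_norm T.
Proof.
by move=> hT; apply: le_trans (@op_norm_ge T M 0 hT _); rewrite ?nrm_ge0 ?nrm0.
Qed.

Lemma nrm_le_op_norm (T : X -> Y) (M : R) (x : X) : linear T ->
  (forall x, nrm (T x) <= M * nrm x) -> nrm (T x) <= op_norm T * nrm x.
Proof.
move=> lT hT; have hT1 y : nrm y <= 1 -> nrm (T y) <= `|M|.
  move=> y1; rewrite (le_trans (hT y))// (@le_trans _ _ (`|M| * nrm y))//.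
    by rewrite ler_wpM2r ?nrm_ge0// ler_norm.
  by rewrite ler_piMr.
have [x0|x0] := eqVneq (nrm x) 0.
  by rewrite (nrm0_eq0 x0) (lin0 lT) !nrm0 mulr0.
have xp : 0 < nrm x by rewrite lt_def x0 nrm_ge0.
rewrite -ler_pdivrMr// mulrC -[in leLHS](gtr0_norm xp) -normfV.
rewrite -nrmZr -(linZ lT) (op_norm_ge hT1)// nrmZr normfV gtr0_norm//.
by rewrite mulVf.
Qed.
End OpNorm.

Section Bilinear.
Context {U V W : normedModType R[i]} (f : U -> V -> W).
Hypothesis linl : forall v, linear (f^~ v).
Hypothesis linr : forall u, linear (f u).

Lemma bilZZ (c d : R[i]) u v : f (c *: u) (d *: v) = c *: (d *: f u v).
Proof. by rewrite (linZ (linl _)) (linZ (linr u)). Qed.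

(** By homogeneity, u and v can be rescaled to norm r. *)
Lemma bilinear_ball_le (r M : R) : 0 < r ->
  (forall u v, nrm u <= r -> nrm v <= r -> nrm (f u v) <= M) ->
  forall u v, nrm (f u v) <= M / r ^+ 2 * nrm u * nrm v.
Proof.
move=> r0 hf u v.
have [u0|u0] := eqVneq (nrm u) 0.
  by rewrite (nrm0_eq0 u0) (lin0 (linl v)) !nrm0 mulr0 mul0r.
have [v0|v0] := eqVneq (nrm v) 0.
  by rewrite (nrm0_eq0 v0) (lin0 (linr u)) !nrm0 mulr0.
have up : 0 < nrm u by rewrite lt_def u0 nrm_ge0.
have vp : 0 < nrm v by rewrite lt_def v0 nrm_ge0.
have := hf ((r / nrm u)%:C *: u) ((r / nrm v)%:C *: v).
have ru : 0 <= r / nrm u by rewrite divr_ge0 ?nrm_ge0// ltW.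
have rv : 0 <= r / nrm v by rewrite divr_ge0 ?nrm_ge0// ltW.
rewrite bilZZ !nrmZr !ger0_norm// !divfK// !lexx => /(_ isT isT) h.
have -> : nrm (f u v) = r / nrm u * (r / nrm v * nrm (f u v))
    / r ^+ 2 * nrm u * nrm v.
  by field; rewrite v0 u0 gt_eqF.
by rewrite !ler_wpM2r ?nrm_ge0// invr_ge0 exprn_ge0// ltW.
Qed.

Lemma bilinear_bounded : continuous (fun z : U * V => f z.1 z.2) ->
  exists2 C : R, 0 <= C & forall u v, nrm (f u v) <= C * nrm u * nrm v.
Proof.
move=> /(_ 0) /cvgrPdist_lt /(_ 1 ltr01) /nbhs_ballP[e /= /gt0_real[r r0 ->]].
move=> hr; have r2 : 0 < r / 2 by rewrite divr_gt0.
exists (1 / (r / 2) ^+ 2) => [|]; first by rewrite divr_ge0// exprn_ge0// ltW.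
apply: bilinear_ball_le => // u v hu hv.
have /= := hr (u, v); rewrite (lin0 (linl 0)) sub0r normrN nrmE.
rewrite -[X in _ < X]/(1%:C) ltcR => h; apply: ltW; apply: h.
have rr : r / 2 < r by rewrite ltr_pdivrMr// mulr_natr mulr2n ltrDl.
by split; rewrite /= -ball_normE /= sub0r normrN ltr_nrm (le_lt_trans _ rr).
Qed.

Lemma bounded_bilinear_continuous (C : R) :
  (forall u v, nrm (f u v) <= C * nrm u * nrm v) ->
  continuous (fun z : U * V => f z.1 z.2).
Proof.
move=> hC0; have [D D0 hC] : exists2 D : R, 0 < D &
    forall u v, nrm (f u v) <= D * nrm u * nrm v.
  exists (`|C| + 1) => [|u v]; first by rewrite ltr_pwDr.
  rewrite (le_trans (hC0 u v))// !ler_wpM2r ?nrm_ge0//.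
  by rewrite (le_trans (ler_norm _))// lerDl.
move=> [u0 v0]; apply/cvgrPdist_lt => e /gt0_real[s s0 ->].
pose B := D * (1 + nrm u0 + nrm v0).
have B0 : 0 < B by rewrite mulr_gt0// -addrA ltr_pwDl// addr_ge0 ?nrm_ge0.
pose d := Num.min 1 (s / B).
have d0 : 0 < d by rewrite lt_min ltr01 divr_gt0.
have nearz : \forall z \near (u0, v0), nrm (u0 - z.1) < d /\ nrm (v0 - z.2) < d.
  apply: filterS (nbhsx_ballx (u0, v0) d%:C _); last by rewrite ltcR.
  by move=> z []; rewrite -!ball_normE /= !ltr_nrm.
near=> z.
have [zu zv] : nrm (u0 - z.1) < d /\ nrm (v0 - z.2) < d by near: z.
rewrite ltr_nrm /=; have -> : f u0 v0 - f z.1 z.2 =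
    f (u0 - z.1) v0 + (f u0 (v0 - z.2) - f (u0 - z.1) (v0 - z.2)).
  rewrite (linB (linr u0)) (linB (linr (u0 - z.1))) (linB (linl v0)).
  rewrite (linB (linl z.2)) opprB [RHS]addrCA [X in _ = _ + X]addrC subrK.
  by rewrite addrA subrK.
apply: (@le_lt_trans _ _ (D * nrm (u0 - z.1) * (nrm v0) +
    (D * nrm u0 * nrm (v0 - z.2) + D * nrm (u0 - z.1) * nrm (v0 - z.2)))).
  rewrite (le_trans (nrmD _ _))// lerD// (le_trans (nrmB _ _))// lerD//.
have d1 : d <= 1 by rewrite ge_min lexx.
apply: (@lt_le_trans _ _ (d * B)); last first.
  by rewrite -ler_pdivlMr// ge_min lexx orbT.
have hn := (nrm_ge0 u0, nrm_ge0 v0, nrm_ge0 (u0 - z.1), nrm_ge0 (v0 - z.2)).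
rewrite /B; apply: (@le_lt_trans _ _ (D * d * nrm v0 + (D * nrm u0 * d +
   D * nrm (u0 - z.1) * 1))).
  have D1 := ltW D0; apply: lerD; last apply: lerD.
  - by rewrite ler_wpM2r ?hn// ler_wpM2l// ltW.
  - by rewrite ler_wpM2l ?mulr_ge0 ?hn// ltW.
  - by rewrite ler_wpM2l ?mulr_ge0 ?hn// (ltW (lt_le_trans zv d1)).
rewrite mulr1.
have -> : d * (D * (1 + nrm u0 + nrm v0)) =
  D * d * nrm v0 + (D * nrm u0 * d + D * d) by ring.
by rewrite !ltrD2l ltr_pM2l.
Unshelve. all: by end_near. Qed.

End Bilinear.
End Bounded.

(** * The Banach space of the free module *)

Section FreeModule.
Context {R : realType} {A : banachAlgType R} {E : completeNormedModType R[i]}.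

(** A test is a candidate target of the universal property: the pair of maps is
    a contractive bilinear map on A_+ * E, cut along A_+ = C + A. *)
Record test := Test {
  test_sp : completeNormedModType R[i] ;
  test_lin : E -> test_sp ;
  test_bil : A -> E -> test_sp ;
  test_lin_linear : linear test_lin ;
  test_bil_linearl : forall x, linear (test_bil^~ x) ;
  test_bil_linearr : forall a, linear (test_bil a) ;
  test_lin_le : forall x, nrm (test_lin x) <= nrm x ;
  test_bil_le : forall a x, nrm (test_bil a x) <= nrm a * nrm x
}.
Implicit Types (t : test) (z : option A * E).

(** The symbols (None, x) and (Some a, x) stand for 1 ⊗ x and a ⊗ x; a word is
    the formal sum of its symbols. *)
Definition word := seq (option A * E).
Implicit Types (w : word) (u v : nat -> word).

Definition atom_val t z : test_sp t :=
  if z.1 is Some a then test_bil t a z.2 else test_lin t z.2.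

Definition word_val t w : test_sp t := \sum_(z <- w) atom_val t z.

Definition word_size w : R :=
  \sum_(z <- w) (if z.1 is Some a then nrm a else 1) * nrm z.2.

Definition word_scale (c : R[i]) w : word := [seq (z.1, c *: z.2) | z <- w].

Lemma word_val_cat t w w' : word_val t (w ++ w') = word_val t w + word_val t w'.
Proof. by rewrite /word_val big_cat. Qed.

Lemma word_val_scale t c w : word_val t (word_scale c w) = c *: word_val t w.
Proof.
rewrite /word_val big_map scaler_sumr; apply: eq_bigr => -[[a|] x] _ /=.
  by rewrite /atom_val /= (linZ (test_bil_linearr t a)).
by rewrite /atom_val /= (linZ (test_lin_linear t)).
Qed.

Lemma word_val_nil t : word_val t [::] = 0.
Proof. by rewrite /word_val big_nil. Qed.

Lemma word_val1 t z : word_val t [:: z] = atom_val t z.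
Proof. by rewrite /word_val big_seq1. Qed.

Lemma word_val_le t w : nrm (word_val t w) <= word_size w.
Proof.
rewrite /word_val /word_size; elim: w => [|z w ih].
  by rewrite !big_nil nrm0.
rewrite !big_cons (le_trans (nrmD _ _))// lerD//.
case: z => -[a|] x /=; first exact: test_bil_le.
by rewrite mul1r; exact: test_lin_le.
Qed.

(** The uniformity in t is what makes this the Cauchy condition for the largest
    seminorm on formal sums under which all tests are contractive. *)
Definition word_cauchy u := forall e : R, 0 < e -> exists N : nat,
  forall m n, (N <= m)%N -> (N <= n)%N ->
    forall t, nrm (word_val t (u m) - word_val t (u n)) <= e.

Definition word_lim t u : test_sp t :=
  xget 0 [set y | cvg_seq (word_val t \o u) y].

Lemma word_limP t u : word_cauchy u -> cvg_seq (word_val t \o u) (word_lim t u).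
Proof.
move=> cu; have [|y uy] := @cauchy_cvg_seq _ _ (word_val t \o u).
  by move=> e /cu[N hN]; exists N => m n Nm Nn; exact: hN.
exact: (@xgetI _ 0 [set y | cvg_seq (word_val t \o u) y] _ uy).
Qed.

Lemma word_lim_eq t u y : cvg_seq (word_val t \o u) y -> word_lim t u = y.
Proof.
move=> uy; apply: (cvg_seq_uniq _ uy).
exact: (@xgetI _ 0 [set y | cvg_seq (word_val t \o u) y] _ uy).
Qed.

Lemma word_cauchy_cst w : word_cauchy (fun=> w).
Proof. by move=> e e0; exists 0%N => m n _ _ t; rewrite subrr nrm0 ltW. Qed.

Lemma word_lim_cst t w : word_lim t (fun=> w) = word_val t w.
Proof. by apply: word_lim_eq; exact: cvg_seq_cst. Qed.

Lemma word_cauchy_cat u v : word_cauchy u -> word_cauchy v ->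
  word_cauchy (fun n => u n ++ v n).
Proof.
move=> cu cv e e0; have e2 : 0 < e / 2 by rewrite divr_gt0.
have [N hN] := cu _ e2; have [M hM] := cv _ e2.
exists (N + M)%N => m n Nm Nn t; rewrite !word_val_cat opprD addrACA.
rewrite (le_trans (nrmD _ _))// [leRHS](splitr e) lerD//.
  by apply: hN; [apply: leq_trans Nm|apply: leq_trans Nn]; exact: leq_addr.
by apply: hM; [apply: leq_trans Nm|apply: leq_trans Nn]; exact: leq_addl.
Qed.

Lemma word_cauchy_scale c u : word_cauchy u ->
  word_cauchy (fun n => word_scale c (u n)).
Proof.
move=> cu e e0; have c1 : 0 < cabs c + 1 by rewrite ltr_pwDr// cabs_ge0.
have [|N hN] := cu (e / (cabs c + 1)); first by rewrite divr_gt0.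
exists N => m n Nm Nn t; rewrite !word_val_scale -scalerBr nrmZ.
set d := nrm _; rewrite (@le_trans _ _ ((cabs c + 1) * d))//.
  by rewrite ler_wpM2r ?nrm_ge0// lerDl.
by rewrite mulrC -ler_pdivlMr// hN.
Qed.

(** The Hausdorff completion of the space of words: classes of Cauchy sequences
    of words that have the same limit in every test.  A class may also contain
    sequences that are not Cauchy, but it has a Cauchy representative. *)
Record free_module := FreeModule {
  free_class : set (nat -> word) ;
  free_classP : exists2 u, word_cauchy u &
    free_class = [set v | forall t, word_lim t u = word_lim t v]
}.

HB.instance Definition _ := gen_eqMixin free_module.
HB.instance Definition _ := gen_choiceMixin free_module.

Definition free_of u (cu : word_cauchy u) : free_module :=
  @FreeModule [set v | forall t, word_lim t u = word_lim t v]
    (ex_intro2 _ _ u cu erefl).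

Definition free_rep (x : free_module) : nat -> word :=
  sval (cid2 (free_classP x)).

Lemma free_rep_cauchy x : word_cauchy (free_rep x).
Proof. by rewrite /free_rep; case: cid2. Qed.

Lemma free_repE x :
  free_class x = [set v | forall t, word_lim t (free_rep x) = word_lim t v].
Proof. by rewrite /free_rep; case: cid2. Qed.

Definition free_val t (x : free_module) : test_sp t := word_lim t (free_rep x).

Lemma free_val_of t u (cu : word_cauchy u) :
  free_val t (free_of cu) = word_lim t u.
Proof.
have : [set v | forall t, word_lim t u = word_lim t v] u by [].
rewrite -[X in X u]/(free_class (free_of cu)) free_repE; exact.
Qed.

(** The tests separate points, so the vector space axioms and the axioms of a
    norm are inherited from the targets of the tests. *)
Lemma free_ext x y : (forall t, free_val t x = free_val t y) -> x = y.
Proof.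
move=> xy; have : free_class x = free_class y.
  rewrite !free_repE; apply/seteqP; split=> v /= h t; rewrite -h.
    by rewrite -[LHS]/(free_val t y) -xy.
  by rewrite -[LHS]/(free_val t x) xy.
case: x y {xy} => [S hS] [S' hS'] /= SS'; case: _ / SS' hS' => hS'.
by congr FreeModule; exact: Prop_irrelevance.
Qed.

Definition free_word w := free_of (word_cauchy_cst w).

Lemma free_val_word t w : free_val t (free_word w) = word_val t w.
Proof. by rewrite free_val_of word_lim_cst. Qed.

Lemma free_dense x (e : R) : 0 < e ->
  exists w, forall t, nrm (free_val t x - word_val t w) <= e.
Proof.
move=> e0; have [N hN] := free_rep_cauchy x e0.
exists (free_rep x N) => t; apply: cvg_seq_le.
  exact: word_limP (free_rep_cauchy x).
by exists N => n Nn; exact: hN.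
Qed.

Lemma free_bounded x : exists M, forall t, nrm (free_val t x) <= M.
Proof.
have [w hw] := free_dense x ltr01; exists (1 + word_size w) => t.
by rewrite (le_trans (nrm_le_sub _ (word_val t w)))// lerD// word_val_le.
Qed.

Definition free_add x y :=
  free_of (word_cauchy_cat (free_rep_cauchy x) (free_rep_cauchy y)).
Definition free_scale c x := free_of (word_cauchy_scale c (free_rep_cauchy x)).
Definition free_zero := free_word [::].
Definition free_opp x := free_scale (-1) x.

Lemma free_valD t x y : free_val t (free_add x y) = free_val t x + free_val t y.
Proof.
rewrite free_val_of; apply: word_lim_eq; move=> e e0.
have [N hN] := cvg_seqD (word_limP t (free_rep_cauchy x))
  (word_limP t (free_rep_cauchy y)) e0.
by exists N => n Nn; rewrite /= word_val_cat; exact: hN.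
Qed.

Lemma free_valZ t c x : free_val t (free_scale c x) = c *: free_val t x.
Proof.
rewrite free_val_of; apply: word_lim_eq; move=> e e0.
have [N hN] := cvg_seqZ c (word_limP t (free_rep_cauchy x)) e0.
by exists N => n Nn; rewrite /= word_val_scale; exact: hN.
Qed.

Lemma free_val0 t : free_val t free_zero = 0.
Proof. by rewrite free_val_word word_val_nil. Qed.

Lemma free_valN t x : free_val t (free_opp x) = - free_val t x.
Proof. by rewrite free_valZ scaleN1r. Qed.

Let freeE := (free_valD, free_valZ, free_val0, free_valN).

Lemma free_addA : associative free_add.
Proof. by move=> x y z; apply: free_ext => t; rewrite !freeE addrA. Qed.
Lemma free_addC : commutative free_add.
Proof. by move=> x y; apply: free_ext => t; rewrite !freeE addrC. Qed.
Lemma free_add0 : left_id free_zero free_add.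
Proof. by move=> x; apply: free_ext => t; rewrite !freeE add0r. Qed.
Lemma free_addN : left_inverse free_zero free_opp free_add.
Proof. by move=> x; apply: free_ext => t; rewrite !freeE addNr. Qed.

HB.instance Definition _ :=
  GRing.isZmodule.Build free_module free_addA free_addC free_add0 free_addN.

Lemma free_scaleA c d x : free_scale c (free_scale d x) = free_scale (c * d) x.
Proof. by apply: free_ext => t; rewrite !freeE scalerA. Qed.
Lemma free_scale1 : left_id 1 free_scale.
Proof. by move=> x; apply: free_ext => t; rewrite !freeE scale1r. Qed.
Lemma free_scaleDr : right_distributive free_scale +%R.
Proof. by move=> c x y; apply: free_ext => t; rewrite !freeE scalerDr. Qed.
Lemma free_scaleDl x : {morph free_scale^~ x : c d / c + d}.
Proof. by move=> c d; apply: free_ext => t; rewrite !freeE scalerDl. Qed.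

HB.instance Definition _ := GRing.Zmodule_isLmodule.Build R[i] free_module
  free_scaleA free_scale1 free_scaleDr free_scaleDl.

Lemma free_val_linear t : linear (free_val t).
Proof. by move=> c x y; rewrite free_valD free_valZ. Qed.

Definition free_norm (x : free_module) : R :=
  sup [set r | exists t, r = nrm (free_val t x)].

Lemma free_norm_ge t x : nrm (free_val t x) <= free_norm x.
Proof.
apply: ub_le_sup; last by exists t.
by have [M hM] := free_bounded x; exists M => _ [t' ->].
Qed.

Lemma free_norm_le x (M : R) : 0 <= M ->
  (forall t, nrm (free_val t x) <= M) -> free_norm x <= M.
Proof.
move=> M0 hM; rewrite /free_norm; set S := (X in sup X).
have [->|/set0P S0] := eqVneq S set0; first by rewrite sup0.
by apply: ge_sup => // _ [t ->].
Qed.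

Definition id_test : test.
Proof.
apply: (@Test E id (fun _ _ => 0)) => // [x c a b|a c x y|a x].
- by rewrite scaler0 addr0.
- by rewrite scaler0 addr0.
- by rewrite nrm0 mulr_ge0 ?nrm_ge0.
Defined.

Lemma free_norm_ge0 x : 0 <= free_norm x.
Proof. exact: le_trans (nrm_ge0 _) (free_norm_ge id_test x). Qed.

Lemma free_normD x y :
  (free_norm (x + y))%:C <= (free_norm x)%:C + (free_norm y)%:C.
Proof.
rewrite -rmorphD lecR free_norm_le// => [|t].
  by rewrite addr_ge0 ?free_norm_ge0.
by rewrite (linD (free_val_linear t)) (le_trans (nrmD _ _))// lerD
  ?free_norm_ge.
Qed.

Lemma free_normZ c x : (free_norm (c *: x))%:C = `|c| * (free_norm x)%:C.
Proof.
rewrite cabsE -rmorphM; congr _%:C; apply/eqP; rewrite eq_le; apply/andP; split.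
  apply: free_norm_le => [|t]; first by rewrite mulr_ge0 ?cabs_ge0 ?free_norm_ge0.
  rewrite (linZ (free_val_linear t)) nrmZ.
  by rewrite ler_wpM2l ?cabs_ge0 ?free_norm_ge.
have [->|c0] := eqVneq (cabs c) 0; first by rewrite mul0r free_norm_ge0.
have cp : 0 < cabs c by rewrite lt_def c0 cabs_ge0.
rewrite mulrC -ler_pdivlMr// free_norm_le// => [|t].
  by rewrite divr_ge0 ?free_norm_ge0// ltW.
by rewrite ler_pdivlMr// mulrC -nrmZ -(linZ (free_val_linear t)) free_norm_ge.
Qed.

Lemma free_norm_eq0 x : (free_norm x)%:C = 0 -> x = 0.
Proof.
move=> /complexI x0; apply: free_ext => t; rewrite (lin0 (free_val_linear t)).
apply: nrm0_eq0; apply/eqP; rewrite eq_le nrm_ge0 andbT -x0.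
exact: free_norm_ge.
Qed.

HB.instance Definition _ := Lmodule_isNormed.Build R[i] free_module
  free_normD free_normZ free_norm_eq0.

Lemma nrm_freeE (x : free_module) : nrm x = free_norm x.
Proof. by []. Qed.

(** Each term of a Cauchy sequence is approximated by a word, and these words
    form a Cauchy sequence that represents the limit. *)
Lemma free_seq_complete (u : nat -> free_module) : cauchy_seq u ->
  exists x, cvg_seq u x.
Proof.
move=> cu; pose r (n : nat) : R := n.+1%:R^-1.
have r0 n : 0 < r n by rewrite invr_gt0.
have /choice[w hw] n : exists w, forall t,
    nrm (free_val t (u n) - word_val t w) <= r n.
  exact: free_dense.
have cw (e : R) : 0 < e -> exists N : nat, forall m n,
    (N <= m)%N -> (N <= n)%N ->
    forall t, nrm (free_val t (u m) - word_val t (w n)) <= e.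
  move=> e0; have e2 : 0 < e / 2 by rewrite divr_gt0.
  have [N hN] := inv_nat_small e2; have [M hM] := cu _ e2.
  exists (N + M)%N => m n Nm Nn t; rewrite [leRHS]splitr.
  rewrite (le_trans (nrmT (free_val t (u n)) _ _))// lerD//.
    rewrite -(linB (free_val_linear t)) (le_trans (free_norm_ge _ _))//.
    by apply: hM; [apply: leq_trans Nm|apply: leq_trans Nn]; exact: leq_addl.
  rewrite (le_trans (hw _ _))// hN//.
  by apply: leq_trans Nn; exact: leq_addr.
have cauchy_w : word_cauchy w.
  move=> e e0; have e2 : 0 < e / 2 by rewrite divr_gt0.
  have [N hN] := cw _ e2; exists N => m n Nm Nn t; rewrite [leRHS]splitr.
  rewrite (le_trans (nrmT (free_val t (u m)) _ _))// lerD//; last exact: hN.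
  by rewrite nrmC; exact: hN.
exists (free_of cauchy_w) => e e0; have [N hN] := cw _ e0.
exists N => n Nn; rewrite nrm_freeE free_norm_le// => [|t]; first exact: ltW.
rewrite (linB (free_val_linear t)) nrmC free_val_of.
apply: cvg_seq_le; first exact: word_limP.
by exists N => m Nm; rewrite nrmC; exact: hN.
Qed.

HB.instance Definition _ :=
  Uniform_isComplete.Build free_module (seq_complete free_seq_complete).

(** gen None x is 1 ⊗ x and gen (Some a) x is a ⊗ x. *)
Definition gen (o : option A) (x : E) : free_module := free_word [:: (o, x)].

Lemma free_val_gen t o x : free_val t (gen o x) = atom_val t (o, x).
Proof. by rewrite free_val_word word_val1. Qed.

Lemma gen_linear o : linear (gen o).
Proof.
move=> c x y; apply: free_ext => t.
rewrite free_val_linear !free_val_gen; case: o => [a|].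
  exact: test_bil_linearr.
exact: test_lin_linear.
Qed.

Lemma gen_linearl x : linear (fun a => gen (Some a) x).
Proof.
move=> c a b; apply: free_ext => t.
rewrite free_val_linear !free_val_gen; exact: test_bil_linearl.
Qed.

Lemma nrm_gen0 x : nrm (gen None x) <= nrm x.
Proof.
rewrite nrm_freeE free_norm_le ?nrm_ge0// => t.
rewrite free_val_gen; exact: test_lin_le.
Qed.

Lemma nrm_gen1 a x : nrm (gen (Some a) x) <= nrm a * nrm x.
Proof.
rewrite nrm_freeE free_norm_le ?mulr_ge0 ?nrm_ge0// => t.
rewrite free_val_gen; exact: test_bil_le.
Qed.

Lemma free_word_sum w : free_word w = \sum_(z <- w) gen z.1 z.2.
Proof.
elim: w => [|z w ih]; first by rewrite big_nil.
rewrite big_cons -ih; apply: free_ext => t.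
rewrite (linD (free_val_linear t)) free_val_gen !free_val_word.
by rewrite -[z :: w]cat1s word_val_cat word_val1; case: z.
Qed.

(** The sums of generators are the words, which are dense. *)
Lemma free_op_uniq (Y : completeNormedModType R[i]) (S T : free_module -> Y) :
  bounded_op free_module Y S -> bounded_op free_module Y T ->
  (forall o x, S (gen o x) = T (gen o x)) -> S =1 T.
Proof.
move=> bS bT ST x; apply/eqP; rewrite -subr_eq0; apply/eqP.
have /bounded_opP[lD [M M0 hD]] := bounded_opB bS bT.
have D0 w : S (free_word w) - T (free_word w) = 0.
  rewrite free_word_sum; elim: w => [|z w ih].
    by rewrite big_nil (lin0 lD).
  rewrite big_cons (linD lD) ih ST.
  by rewrite subrr add0r.
apply: (@nrm_small _ _ _ M) => e e0; have [w hw] := free_dense x e0.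
have -> : S x - T x = S (x - free_word w) - T (x - free_word w).
  by rewrite (linB lD) D0 subr0.
rewrite (le_trans (hD _))// ler_wpM2l// nrm_freeE free_norm_le// => [|t].
  exact: ltW.
by rewrite (linB (free_val_linear t)) free_val_word.
Qed.

(** Divided by M, the pair (psi, phi) is a test, and evaluation at this test is
    the required operator.  The bound M of the operator is what the norm
    estimates for free modules rely on. *)
Lemma free_lift (Y : completeNormedModType R[i]) (psi : E -> Y)
    (phi : A -> E -> Y) (M : R) : 0 <= M ->
  linear psi -> (forall x, linear (phi^~ x)) -> (forall a, linear (phi a)) ->
  (forall x, nrm (psi x) <= M * nrm x) ->
  (forall a x, nrm (phi a x) <= M * (nrm a * nrm x)) ->
  exists T : free_module -> Y,
    [/\ linear T, forall x, nrm (T x) <= M * nrm x,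
        forall x, T (gen None x) = psi x &
        forall a x, T (gen (Some a) x) = phi a x].
Proof.
rewrite le_eqVlt => /predU1P[<- lpsi _ _ hpsi hphi|M0 lpsi phil phir hpsi hphi].
  exists (fun=> 0); split=> [c x y|x|x|a x].
  - by rewrite scaler0 addr0.
  - by rewrite nrm0 mul0r.
  - apply/esym/nrm0_eq0/eqP; rewrite eq_le nrm_ge0 andbT.
    by rewrite (le_trans (hpsi x))// mul0r.
  - apply/esym/nrm0_eq0/eqP; rewrite eq_le nrm_ge0 andbT.
    by rewrite (le_trans (hphi a x))// mul0r.
have Mi : 0 <= M^-1 by rewrite invr_ge0 ltW.
have MM : M%:C * (M^-1)%:C = 1 by rewrite -rmorphM mulfV// gt_eqF.
have h1 : linear (fun x => (M^-1)%:C *: psi x).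
  by move=> c x y; rewrite lpsi scalerDr !scalerA mulrC.
have h2 x : linear (fun a => (M^-1)%:C *: phi a x).
  by move=> c a b; rewrite phil scalerDr !scalerA mulrC.
have h3 a : linear (fun x => (M^-1)%:C *: phi a x).
  by move=> c x y; rewrite phir scalerDr !scalerA mulrC.
have h4 x : nrm ((M^-1)%:C *: psi x) <= nrm x.
  by rewrite nrmZr ger0_norm// mulrC ler_pdivrMr// mulrC.
have h5 a x : nrm ((M^-1)%:C *: phi a x) <= nrm a * nrm x.
  by rewrite nrmZr ger0_norm// mulrC ler_pdivrMr// mulrC.
pose t := Test h1 h2 h3 h4 h5.
exists (fun x => M%:C *: free_val t x); split=> [c x y|x|x|a x].
- by rewrite free_val_linear scalerDr !scalerA mulrC.
- by rewrite nrmZr gtr0_norm// ler_wpM2l ?(ltW M0)// free_norm_ge.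
- by rewrite free_val_gen /atom_val /= scalerA MM scale1r.
- by rewrite free_val_gen /atom_val /= scalerA MM scale1r.
Qed.
End FreeModule.
Arguments free_module {R} A E.

(** * The module structure and its universal property *)

Section Action.
Context {R : realType} {A : banachAlgType R}.

Lemma nrm_bmul (a b : A) : nrm (bmul a b) <= nrm a * nrm b.
Proof. by have := ler_norm_bmul a b; rewrite !nrmE -rmorphM lecR. Qed.

Lemma bact_bounded (X : banachModType A) : exists2 C : R, 0 <= C &
  forall (a : A) (x : X), nrm (bact a x) <= C * nrm a * nrm x.
Proof.
apply: bilinear_bounded; [exact: bact_linearl|exact: bact_linearr|].
exact: bact_continuous.
Qed.

Lemma bounded_bact (X : banachModType A) (a : A) : bounded_op X X (bact a).
Proof.
apply/bounded_opP; split; first exact: bact_linearr.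
have [C C0 hC] := bact_bounded X.
by exists (C * nrm a) => //; rewrite mulr_ge0 ?nrm_ge0.
Qed.

Section FreeAction.
Context {E : completeNormedModType R[i]}.
Local Notation F := (free_module A E).

Lemma free_act_subproof (a : A) : exists T : F -> F,
    [/\ linear T, forall x, nrm (T x) <= nrm a * nrm x,
        forall x, T (gen None x) = gen (Some a) x &
        forall b x, T (gen (Some b) x) = gen (Some (bmul a b)) x].
Proof.
apply: free_lift => [||x|b|x|b x].
- exact: nrm_ge0.
- exact: gen_linear.
- move=> c b b'; rewrite (bmul_linearr a); exact: gen_linearl.
- exact: gen_linear.
- exact: nrm_gen1.
- by rewrite (le_trans (nrm_gen1 _ _))// mulrA ler_wpM2r ?nrm_ge0// nrm_bmul.
Qed.

Definition free_act (a : A) : F -> F := sval (cid (free_act_subproof a)).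

(** The action of a is the operator with 1 ⊗ x |-> a ⊗ x and
    b ⊗ x |-> ab ⊗ x. *)
Lemma free_actP (a : A) :
    [/\ linear (free_act a), forall x, nrm (free_act a x) <= nrm a * nrm x,
        forall x, free_act a (gen None x) = gen (Some a) x &
        forall b x, free_act a (gen (Some b) x) = gen (Some (bmul a b)) x].
Proof. by rewrite /free_act; case: cid. Qed.

Lemma free_act_linearr a : linear (free_act a).
Proof. by case: (free_actP a). Qed.

Lemma free_act_le a x : nrm (free_act a x) <= nrm a * nrm x.
Proof. by case: (free_actP a). Qed.

Lemma free_act_gen a o x : free_act a (gen o x) =
  gen (Some (if o is Some b then bmul a b else a)) x.
Proof. by case: (free_actP a) o => _ _ h0 h1 [b|]. Qed.

Lemma bounded_free_act a : bounded_op F F (free_act a).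
Proof.
apply/bounded_opP; split; first exact: free_act_linearr.
by exists (nrm a); [exact: nrm_ge0|exact: free_act_le].
Qed.

Lemma free_actA a b x : free_act a (free_act b x) = free_act (bmul a b) x.
Proof.
apply: (@free_op_uniq _ _ _ _ (free_act a \o free_act b)
    (free_act (bmul a b))) => [||[c|] y].
- exact: bounded_op_comp (bounded_free_act a) (bounded_free_act b).
- exact: bounded_free_act.
- by rewrite /= !free_act_gen bmulA.
- by rewrite /= !free_act_gen.
Qed.

Lemma free_act_linearl x : linear (free_act^~ x).
Proof.
move=> c a b; apply: (@free_op_uniq _ _ _ _ (free_act (c *: a + b))
  (fun x => c *: free_act a x + free_act b x)) => [||o y].
- exact: bounded_free_act.
- apply: bounded_opD; last exact: bounded_free_act.
  have /bounded_opP[l [M M0 hM]] := bounded_free_act a.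
  apply/bounded_opP; split=> [d u v|].
    by rewrite l scalerDr !scalerA mulrC.
  exists (cabs c * M) => [|u]; first by rewrite mulr_ge0// cabs_ge0.
  by rewrite nrmZ -mulrA ler_wpM2l ?cabs_ge0.
- rewrite !free_act_gen; case: o => [d|]; last exact: gen_linearl.
  by rewrite (bmul_linearl d); exact: gen_linearl.
Qed.

Lemma free_act_continuous :
  continuous (fun z : A * F => free_act z.1 z.2).
Proof.
apply: (@bounded_bilinear_continuous _ _ _ _ free_act _ _ 1) => [x|a|a x].
- exact: free_act_linearl.
- exact: free_act_linearr.
- by rewrite mul1r free_act_le.
Qed.

HB.instance Definition _ := isBanachModule.Build R A F
  free_actA free_act_linearl free_act_linearr free_act_continuous.

Lemma bact_gen (a : A) o (x : E) : bact a (gen o x : F) =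
  gen (Some (if o is Some b then bmul a b else a)) x.
Proof. exact: free_act_gen. Qed.

Lemma bact_gen0 (a : A) (x : E) : bact a (gen None x : F) = gen (Some a) x.
Proof. exact: bact_gen. Qed.

Lemma bounded_gen : bounded_op E F (gen None).
Proof.
apply/bounded_opP; split; first exact: gen_linear.
by exists 1 => // x; rewrite mul1r nrm_gen0.
Qed.

Lemma free_hom_uniq (X : banachModType A) (S T : F -> X) :
  module_hom F X S -> module_hom F X T ->
  (forall x, S (gen None x) = T (gen None x)) -> S =1 T.
Proof.
move=> [bS hS] [bT hT] ST; apply: free_op_uniq => // -[a|] x //.
by rewrite -bact_gen0 hS hT ST.
Qed.

(** An operator T extends to the morphism with a ⊗ x |-> a T(x), which is
    A-linear because it is so on generators. *)
Lemma free_hom_lift (X : banachModType A) (T : E -> X) : bounded_op E X T ->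
  exists2 S : F -> X, module_hom F X S & forall x, S (gen None x) = T x.
Proof.
move=> /bounded_opP[lT [M M0 hT]]; have [C C0 hC] := bact_bounded X.
have [||x|a|x|a x|S [lS hS S0 S1]] := @free_lift R A E X T
    (fun a x => bact a (T x)) (M + C * M).
- by rewrite addr_ge0// mulr_ge0.
- exact: lT.
- exact: bact_linearl.
- by move=> c x y; rewrite lT bact_linearr.
- by rewrite (le_trans (hT x))// ler_wpM2r ?nrm_ge0// lerDl mulr_ge0.
- rewrite (le_trans (hC _ _))// (@le_trans _ _ (C * nrm a * (M * nrm x)))//.
    by rewrite ler_wpM2l// mulr_ge0// nrm_ge0.
  rewrite [leLHS](_ : _ = C * M * (nrm a * nrm x)); last by ring.
  by rewrite ler_wpM2r ?mulr_ge0 ?nrm_ge0// lerDr.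
have bS : bounded_op F X S.
  apply/bounded_opP; split=> //; exists (M + C * M) => //.
  by rewrite addr_ge0// mulr_ge0.
exists S => //; split=> // a.
apply: (@free_op_uniq _ _ _ _ (S \o bact a) (bact a \o S)) => [||[b|] x].
- exact: bounded_op_comp bS (bounded_bact _ a).
- exact: bounded_op_comp (bounded_bact _ a) bS.
- by rewrite /= bact_gen !S1 bactA.
- by rewrite /= bact_gen S1 S0.
Qed.

(** It is enough to lift phi on the generators 1 ⊗ x, as a bounded linear map,
    and this is what a bounded linear section of s does. *)
Lemma free_projective : projective F.
Proof.
move=> X Y s phi [hs [t bt st]] hphi.
have [S hS S0] : exists2 S : F -> X, module_hom F X S &
    forall x, S (gen None x) = t (phi (gen None x)).
  apply: (@free_hom_lift X (fun x => t (phi (gen None x)))).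
  exact: bounded_op_comp bt (bounded_op_comp hphi.1 bounded_gen).
exists S => //; apply/funext; apply: free_hom_uniq => // [|x].
  split; first exact: bounded_op_comp hs.1 hS.1.
  by move=> a x /=; rewrite hS.2 hs.2.
by rewrite /= S0 -[LHS]/((s \o t) _) st.
Qed.
End FreeAction.

Lemma free_counit (X : banachModType A) :
  exists2 e : free_module A X -> X, module_hom (free_module A X) X e &
    forall x, e (gen None x) = x.
Proof. exact: free_hom_lift (@bounded_op_id _ X). Qed.

Lemma free_counit_epi (X : banachModType A) (e : free_module A X -> X) :
  module_hom (free_module A X) X e -> (forall x, e (gen None x) = x) ->
  admissible_epi e.
Proof.
move=> he e0; split=> //; exists (gen None); first exact: bounded_gen.
by apply/funext => x; exact: e0.
Qed.

Lemma module_hom_comp (X Y Z : banachModType A) (S : Y -> Z) (T : X -> Y) :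
  module_hom Y Z S -> module_hom X Y T -> module_hom X Z (S \o T).
Proof.
move=> [bS hS] [bT hT]; split; first exact: bounded_op_comp bS bT.
by move=> a x /=; rewrite hT hS.
Qed.

Lemma module_hom_id (X : banachModType A) : module_hom X X id.
Proof. by split=> //; exact: bounded_op_id. Qed.

Lemma projective_retract (P F : banachModType A) (i : P -> F) (p : F -> P) :
  module_hom P F i -> module_hom F P p -> p \o i = id ->
  projective F -> projective P.
Proof.
move=> hi hp pi pF X Y s phi es hphi.
have [psi hpsi spsi] := pF X Y s _ es (module_hom_comp hphi hp).
exists (psi \o i); first exact: module_hom_comp.
by rewrite compA spsi -compA pi.
Qed.

(** On the free module over P the pull-back of f is the coboundary of the
    operator S with S(1 ⊗ x) = 0 and S(a ⊗ x) = - f(a, x); a module section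
    s of the counit brings it back to P. *)
Lemma projective_Z1 (P X : banachModType A) (f : A * P -> X) :
  projective P -> Z1 P X f -> exists2 T, bounded_op P X T & delta0 T = f.
Proof.
move=> pP [cf fl fr fZ]; have [e he e0] := free_counit P.
have [s hs es] := pP _ _ _ _ (free_counit_epi he e0) (@module_hom_id P).
have [C C0 hC] : exists2 C : R, 0 <= C &
    forall (a : A) (x : P), nrm (f (a, x)) <= C * nrm a * nrm x.
  apply: (@bilinear_bounded _ _ _ _ (fun a x => f (a, x))) => //.
  by rewrite [X in continuous X](_ : _ = f)//; apply/funext => -[].
have [|x|a|x|a x|S [lS hS S0 S1]] := @free_lift R A P X (fun=> 0)
    (fun a x => - f (a, x)) C C0.
- by move=> c x y; rewrite scaler0 addr0.
- by move=> c a b; rewrite fl opprD scalerN.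
- by move=> c x y; rewrite fr opprD scalerN.
- by rewrite nrm0 mulr_ge0// nrm_ge0.
- by rewrite nrmN mulrA.
have bS : bounded_op (free_module A P) X S.
  by apply/bounded_opP; split=> //; exists C.
have dS a u : bact a (S u) - S (bact a u) = f (a, e u).
  apply: (@free_op_uniq _ _ _ _ (fun u => bact a (S u) - S (bact a u))
     (fun u => f (a, e u))) => [||[b|] x].
  - apply: bounded_opB; first exact: bounded_op_comp (bounded_bact _ a) bS.
    exact: bounded_op_comp bS (bounded_bact _ a).
  - apply: (@bounded_op_comp _ _ _ _ (fun x => f (a, x))) he.1.
    apply/bounded_opP; split; first exact: fr.
    by exists (C * nrm a) => //; rewrite mulr_ge0 ?nrm_ge0.
  - rewrite bact_gen !S1 (linN (bact_linearr a)) opprK.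
    rewrite -(bact_gen0 b) he.2 e0; apply/esym/eqP.
    by rewrite -subr_eq0 opprD opprK addrC fZ.
  - by rewrite bact_gen0 S0 S1 (lin0 (bact_linearr a)) sub0r opprK e0.
exists (S \o s); first exact: bounded_op_comp bS hs.1.
apply/funext => -[a x]; rewrite /delta0 /= hs.2 dS.
by rewrite -[e (s x)]/((e \o s) x) es.
Qed.
End Action.

(** * Kernels of morphisms *)

Section Kernel.
Context {R : realType} {A : banachAlgType R} {F P : banachModType A}.
Context {p : F -> P} (hp : module_hom F P p).

(** The proof that p is a morphism is an argument, so that the closure of the
    kernel under linear combinations can be inferred from the predicate. *)
Definition in_kernel of module_hom F P p : {pred F} := fun x => p x == 0.

Lemma in_kernelE x : (x \in in_kernel hp) = (p x == 0).
Proof. by []. Qed.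

Lemma in_kernel_closed : submod_closed (in_kernel hp).
Proof.
have lp := hp.1.1; split; first by rewrite in_kernelE (lin0 lp).
by move=> c x y; rewrite !in_kernelE => /eqP x0 /eqP y0; rewrite lp x0 y0
  scaler0 addr0.
Qed.

HB.instance Definition _ :=
  GRing.isSubmodClosed.Build R[i] F (in_kernel hp) in_kernel_closed.

Record hom_kernel := HomKernel {
  kernel_val : F ; kernel_valP : kernel_val \in in_kernel hp }.

HB.instance Definition _ := [isSub of hom_kernel for kernel_val].
HB.instance Definition _ := [Choice of hom_kernel by <:].
HB.instance Definition _ := [SubChoice_isSubLmodule of hom_kernel by <:].

Lemma kernel_val_linear : linear kernel_val.
Proof. by move=> c x y; exact: (@linearP _ _ _ _ (val : hom_kernel -> F)). Qed.

Lemma kernel_inj : injective kernel_val.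
Proof. exact: val_inj. Qed.

Lemma kernel_normD (x y : hom_kernel) :
  `|kernel_val (x + y)| <= `|kernel_val x| + `|kernel_val y|.
Proof. by rewrite (linD kernel_val_linear) ler_normD. Qed.

Lemma kernel_normZ c (x : hom_kernel) :
  `|kernel_val (c *: x)| = `|c| * `|kernel_val x|.
Proof. by rewrite (linZ kernel_val_linear) normrZ. Qed.

Lemma kernel_norm_eq0 (x : hom_kernel) : `|kernel_val x| = 0 -> x = 0.
Proof.
move=> /normr0_eq0 x0; apply: kernel_inj.
by rewrite x0 (lin0 kernel_val_linear).
Qed.

HB.instance Definition _ := Lmodule_isNormed.Build R[i] hom_kernel
  kernel_normD kernel_normZ kernel_norm_eq0.

Lemma nrm_kernelE (x : hom_kernel) : nrm x = nrm (kernel_val x).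
Proof. by []. Qed.

Lemma kernel_seq_complete (u : nat -> hom_kernel) : cauchy_seq u ->
  exists x, cvg_seq u x.
Proof.
move=> cu; have [|y uy] := @cauchy_cvg_seq _ F (kernel_val \o u).
  move=> e /cu[N hN]; exists N => m n Nm Nn.
  by rewrite /= -(linB kernel_val_linear) -nrm_kernelE hN.
have y0 : y \in in_kernel hp.
  have [lp [M M0 hM]] := (bounded_opP _).1 hp.1.
  rewrite in_kernelE; apply/eqP; apply: (@cvg_seq_uniq _ _ (fun=> 0)).
    move=> e e0; have [N hN] := cvg_seq_bdd lp hM uy e0.
    exists N => n /hN /=; have := kernel_valP (u n).
    by rewrite in_kernelE => /eqP ->.
  exact: cvg_seq_cst.
exists (HomKernel y0) => e /uy[N hN]; exists N => n Nn.
by rewrite nrm_kernelE (linB kernel_val_linear) hN.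
Qed.

HB.instance Definition _ :=
  Uniform_isComplete.Build hom_kernel (seq_complete kernel_seq_complete).

Lemma kernel_act_subproof (a : A) (x : hom_kernel) :
  bact a (kernel_val x) \in in_kernel hp.
Proof.
have := kernel_valP x; rewrite !in_kernelE hp.2 => /eqP ->.
by rewrite (lin0 (bact_linearr a)).
Qed.

Definition kernel_act a x := HomKernel (kernel_act_subproof a x).

Lemma kernel_actA a b x : kernel_act a (kernel_act b x) = kernel_act (bmul a b) x.
Proof. by apply: kernel_inj; exact: bactA. Qed.

Lemma kernel_act_linearl x : linear (kernel_act^~ x).
Proof.
move=> c a b; apply: kernel_inj; rewrite kernel_val_linear.
exact: bact_linearl.
Qed.

Lemma kernel_act_linearr a : linear (kernel_act a).
Proof.
move=> c x y; apply: kernel_inj; rewrite kernel_val_linear.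
by rewrite -[LHS]/(bact a (kernel_val (c *: x + y))) kernel_val_linear
  bact_linearr.
Qed.

Lemma kernel_act_continuous :
  continuous (fun z : A * hom_kernel => kernel_act z.1 z.2).
Proof.
have [C C0 hC] := bact_bounded F.
apply: (@bounded_bilinear_continuous _ _ _ _ kernel_act _ _ C).
- exact: kernel_act_linearl.
- exact: kernel_act_linearr.
- by move=> a x; rewrite !nrm_kernelE; exact: hC.
Qed.

HB.instance Definition _ := isBanachModule.Build R A hom_kernel
  kernel_actA kernel_act_linearl kernel_act_linearr kernel_act_continuous.

Lemma kernel_val_hom : module_hom hom_kernel F kernel_val.
Proof.
split=> //; apply/bounded_opP; split; first exact: kernel_val_linear.
by exists 1 => // x; rewrite mul1r.
Qed.

Lemma kernel_val0 x : p (kernel_val x) = 0.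
Proof. by have := kernel_valP x; rewrite in_kernelE => /eqP. Qed.

Lemma kernel_lift (X : completeNormedModType R[i]) (T : X -> F) :
  bounded_op X F T -> (forall x, p (T x) = 0) ->
  exists2 S : X -> hom_kernel, bounded_op X hom_kernel S &
    forall x, kernel_val (S x) = T x.
Proof.
move=> /bounded_opP[lT [M M0 hT]] pT.
have inT x : T x \in in_kernel hp by rewrite in_kernelE pT.
exists (fun x => HomKernel (inT x)) => //; apply/bounded_opP; split.
  move=> c x y; apply: kernel_inj; rewrite kernel_val_linear; exact: lT.
by exists M => // x; rewrite nrm_kernelE hT.
Qed.
End Kernel.
Arguments hom_kernel {R A F P p} hp.
Arguments kernel_val_linear {R A F P p} hp.
Arguments kernel_val_hom {R A F P p} hp.

(** * The Neumann series and the splitting criterion *)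

Section Neumann.
Context {R : realType}.

(** From nrm (u k - k) <= nrm k / 2 it follows that nrm k <= 2 * nrm (u k),
    which gives injectivity and the bound 2 for the inverse.  The solution of
    u k = y is the limit of the partial sums of the Neumann series. *)
Lemma neumann_inverse (K : completeNormedModType R[i]) (u : K -> K) :
  linear u -> (forall k, nrm (u k - k) <= 2^-1 * nrm k) ->
  exists2 v : K -> K, bounded_op K K v &
    (forall k, u (v k) = k) /\ (forall k, v (u k) = k).
Proof.
move=> lu hu.
have low k : nrm k <= 2 * nrm (u k).
  have := nrm_le_sub k (u k); have := hu k; rewrite nrmC; lra.
have ui k l : u k = u l -> k = l.
  move=> kl; apply/eqP; rewrite -subr_eq0; apply/eqP/nrm0_eq0/eqP.
  rewrite eq_le nrm_ge0 andbT (le_trans (low _))// (linB lu) kl subrr nrm0.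
  by rewrite mulr0.
have us y : exists k, u k = y.
  (* Each step at least halves the residue y - u (s n). *)
  pose s := fix s n := if n is m.+1 then s m + (y - u (s m)) else 0.
  have res n : nrm (y - u (s n)) <= 2^-1 ^+ n * nrm y.
    elim: n => [|n ih]; first by rewrite /= (lin0 lu) subr0 expr0 mul1r.
    rewrite /= (linD lu) opprD addrA nrmC (le_trans (hu _))//.
    by rewrite exprS -mulrA ler_wpM2l ?invr_ge0.
  have us m n : (m <= n)%N -> nrm (y - u (s n)) <= 2^-1 ^+ m * nrm y.
    move=> mn; rewrite (le_trans (res n))// ler_wpM2r ?nrm_ge0//.
    by rewrite ler_wiXn2l ?invr_ge0// invf_le1// ler1n.
  have dist m n N : (N <= m)%N -> (N <= n)%N ->
      nrm (s m - s n) <= 4 * (2^-1 ^+ N * nrm y).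
    move=> Nm Nn; rewrite (le_trans (low _))//.
    have := nrmT y (u (s m)) (u (s n)); rewrite -(linB lu) (nrmC (u (s m))).
    by have := us _ _ Nm; have := us _ _ Nn; lra.
  have small (e : R) : 0 < e -> exists N, 4 * (2^-1 ^+ N * nrm y) <= e.
    move=> e0; have C0 : 0 < 4 * nrm y + 1 by rewrite ltr_wpDl ?mulr_ge0 ?nrm_ge0.
    have [N hN] := archi_ex ((4 * nrm y + 1) / e); exists N.
    have N2 : N%:R <= 2 ^+ N :> R by rewrite -natrX ler_nat ltnW// ltn_expl.
    rewrite mulrCA exprVn mulrC ler_pdivrMr ?exprn_gt0//.
    move: hN; rewrite ler_pdivrMr// => hN.
    by have := ler_wpM2r (ltW e0) N2; lra.
  have [|k sk] := cauchy_cvg_seq (u := s).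
    move=> e /small[N hN]; exists N => m n Nm Nn.
    exact: le_trans (dist _ _ _ Nm Nn) hN.
  exists k; have usk : cvg_seq (u \o s) (u k).
    apply: (@cvg_seq_bdd _ _ _ u 2) => // x.
    by have := nrm_le_sub (u x) x; have := hu x; have := nrm_ge0 x; lra.
  apply: cvg_seq_uniq usk _ => e /small[N hN]; exists N => n Nn /=.
  rewrite nrmC (le_trans _ hN)// (le_trans (us _ _ Nn))// ler_peMl//.
    by rewrite mulr_ge0 ?nrm_ge0// exprn_ge0// invr_ge0.
  by rewrite ler1n.
have /choice[v hv] := us.
exists v; last by split=> // k; apply: ui; rewrite hv.
apply/bounded_opP; split=> [c x y|]; first by apply: ui; rewrite lu !hv.
by exists 2 => // k; rewrite (le_trans (low _))// hv.
Qed.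
End Neumann.

Section Splitting.
Context {R : realType} {A : banachAlgType R}.

(** With v the inverse of the restriction of g to the kernel, v g is a module
    retraction onto the kernel.  Then q = 1 - v g kills the kernel, so it
    factors through e, and the factor is a module section of e. *)
Lemma near_retraction_projective (F P : banachModType A) (e : F -> P)
    (he : admissible_epi e) (g : F -> hom_kernel he.1) :
  projective F -> module_hom F (hom_kernel he.1) g ->
  (forall k, nrm (g (kernel_val k) - k) <= 2^-1 * nrm k) -> projective P.
Proof.
move=> pF hg gk; set K := hom_kernel he.1 in g hg gk *.
have hj : module_hom K F (@kernel_val _ _ _ _ _ he.1) by exact: kernel_val_hom.
set j := @kernel_val _ _ _ _ _ he.1 in hj gk *.
have hu : module_hom K K (g \o j) by exact: module_hom_comp hg hj.
have [v bv [uv vu]] := neumann_inverse hu.1.1 gk.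
have hv : module_hom K K v.
  by split=> // a k; rewrite -[in LHS](uv k) -hu.2 vu.
have hr : module_hom F F (j \o (v \o g)).
  exact: module_hom_comp hj (module_hom_comp hv hg).
pose q x := x - j (v (g x)).
have lr : linear (fun x => j (v (g x))) := hr.1.1.
have rA a x : j (v (g (bact a x))) = bact a (j (v (g x))) by exact: hr.2.
have lq : linear q by move=> c x y; rewrite /q lr scalerBr opprD addrACA.
have q0 x : e x = 0 -> q x = 0.
  move=> ex; have [k <-] : exists k : K, j k = x.
    have xK : x \in in_kernel he.1 by rewrite in_kernelE ex.
    by exists (HomKernel xK).
  by rewrite /q vu subrr.
have [t bt et] := he.2; have {}et x : e (t x) = x by rewrite -[LHS]/((e \o t) x) et.
have qe x : q (t (e x)) = q x.
  by apply/eqP; rewrite -subr_eq0 -(linB lq) q0// (linB he.1.1.1) et subrr.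
have bq : bounded_op F F q.
  by apply: bounded_opB hr.1; exact: bounded_op_id.
apply: (projective_retract (i := q \o t) _ he.1 _ pF).
  split; first exact: bounded_op_comp bq bt.
  move=> a x /=; rewrite -[in LHS](et x) -he.1.2 qe /q rA.
  by rewrite (linB (bact_linearr a)).
by apply/funext => x /=; rewrite (linB he.1.1.1) et kernel_val0 subr0.
Qed.
End Splitting.

(** * The bar resolution *)

Section BarResolution.
Context {R : realType} {A : banachAlgType R}.

(** A stage is a term Q of the augmented resolution with the differential into
    it from the next term, the free module F(Q).  The next differential
    d' : F(F(Q)) -> F(Q) is the morphism with d'(1 ⊗ x) = x - 1 ⊗ d(x), so
    that x |-> 1 ⊗ x is a contracting homotopy by construction. *)
Record stage := Stage {
  stage_mod : banachModType A ;
  stage_map : free_module A stage_mod -> stage_mod ;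
  stage_hom : module_hom (free_module A stage_mod) stage_mod stage_map
}.

Lemma next_stage_subproof (s : stage) :
  exists2 d : free_module A (free_module A (stage_mod s)) ->
      free_module A (stage_mod s),
    module_hom (free_module A (free_module A (stage_mod s)))
      (free_module A (stage_mod s)) d &
    forall x, d (gen None x) = x - gen None (stage_map x).
Proof.
apply: (@free_hom_lift R A (free_module A (stage_mod s))
  (free_module A (stage_mod s)) (fun x => x - gen None (stage_map x))).
apply: bounded_opB; first exact: bounded_op_id.
exact: bounded_op_comp bounded_gen (stage_hom s).1.
Qed.

Definition next_stage (s : stage) : stage :=
  Stage (s2valP (cid2 (next_stage_subproof s))).

Lemma next_stage_gen (s : stage) (x : free_module A (stage_mod s)) :
  @stage_map (next_stage s) (gen None x) = x - gen None (stage_map x).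
Proof. exact: (s2valP' (cid2 (next_stage_subproof s))). Qed.

Section Resolution.
Context {P : banachModType A} {e : free_module A P -> P}.
Hypothesis he : module_hom (free_module A P) P e.
Hypothesis e0 : forall x, e (gen None x) = x.

Fixpoint stages (n : nat) : stage :=
  if n is m.+1 then next_stage (stages m) else Stage he.

(** On generators d'(d''(1 ⊗ x)) = d'(x) - d'(1 ⊗ d'(x)) = 1 ⊗ d(d'(x)), which
    is an induction on the stages. *)
Lemma stages_comp0 n (x : free_module A (stage_mod (stages n.+1))) :
  stage_map (stage_map x) = 0 :> stage_mod (stages n).
Proof.
have c0 (s : stage) :
    (forall y : free_module A (stage_mod s),
      stage_map (@stage_map (next_stage s) (gen None y)) = 0) ->
    forall x : free_module A (stage_mod (next_stage s)),
      stage_map (@stage_map (next_stage s) x) = 0.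
  move=> h y; apply: (@free_hom_uniq _ _ _ _
    (@stage_map s \o @stage_map (next_stage s)) (fun=> 0)) => //.
    exact: module_hom_comp (stage_hom s) (stage_hom (next_stage s)).
  split; last by move=> a z; rewrite (lin0 (bact_linearr a)).
  apply/bounded_opP; split=> [c u v|]; first by rewrite scaler0 addr0.
  by exists 0 => // u; rewrite nrm0 mul0r.
elim: n x => [|n ih]; apply: c0 => x.
  by rewrite next_stage_gen -[LHS]/(e (x - gen None (e x))) (linB he.1.1) e0 subrr.
rewrite next_stage_gen (linB (stage_hom _).1.1).
by rewrite -/stages next_stage_gen ih (lin0 (@gen_linear _ _ _ _)) subr0 subrr.
Qed.

Definition bar_resolution : projective_resolution P.
Proof.
apply: (@ProjectiveResolution R A P (fun n => free_module A (stage_mod (stages n)))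
  (fun n => @stage_map (stages n.+1)) e) => [n|n||n x|x|].
- exact: free_projective.
- exact: stage_hom.
- exact: he.
- exact: (@stages_comp0 n.+1).
- exact: (@stages_comp0 0).
- exists (gen None), (fun n => gen None); split=> [|n|x|x|n x].
  + exact: bounded_gen.
  + exact: bounded_gen.
  + exact: e0.
  + by rewrite next_stage_gen addrC subrK.
  + by rewrite next_stage_gen addrC subrK.
Defined.

Lemma bar_resolution_d0_gen (x : free_module A P) :
  res_d bar_resolution 0 (gen None x) = x - gen None (e x).
Proof. exact: next_stage_gen (Stage he) x. Qed.

Lemma bar_resolution_aug_d0 x : e (res_d bar_resolution 0 x) = 0.
Proof. exact: (@stages_comp0 0). Qed.
End Resolution.
End BarResolution.

(** * Nets and norm convergence *)

Section Nets.
Context {R : realType}.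

Definition nat_directed : directedType.
Proof.
apply: (@DirectedType _ nat); first exact: inhabits 0%N.
by move=> i j; exists (maxn i j); rewrite !leEnat leq_maxl leq_maxr.
Defined.

Lemma cvg_tails0 {I : directedType} (f : I -> R) :
  f i @[i --> tails I] --> (0 : R) <->
  forall e : R, 0 < e -> exists i, forall j, (i <= j)%O -> `|f j| <= e.
Proof.
split=> [/cvgr0Pnorm_le h e /h [i _ hi]|h]; first by exists i.
by apply/cvgr0Pnorm_le => e /h [i hi]; exists i.
Qed.

Lemma norm_cvgP {I : directedType} {X Y : completeNormedModType R[i]}
    (T_ : I -> X -> Y) (T : X -> Y) :
  (forall i, bounded_op X Y (T_ i)) -> bounded_op X Y T ->
  norm_cvg T_ T <->
  forall e : R, 0 < e -> exists i, forall j, (i <= j)%O ->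
    forall x, nrm (T_ j x - T x) <= e * nrm x.
Proof.
move=> bT_ bT; apply: (iff_trans (cvg_tails0 _)); split=> h e e0;
    have [i hi] := h e e0; exists i => j /hi {}hi.
  move=> x; have /bounded_opP[l [M M0 hM]] := bounded_opB (bT_ j) bT.
  have := nrm_le_op_norm x l hM; move/le_trans; apply.
  by rewrite ler_wpM2r ?nrm_ge0// (le_trans (ler_norm _) hi).
have h1 x : nrm x <= 1 -> nrm ((T_ j \- T) x) <= e.
  by move=> x1; rewrite (le_trans (hi x))// ler_piMr// ltW.
rewrite ger0_norm; last exact: op_norm_ge0 h1.
by apply: op_norm_le => //; exact: ltW.
Qed.

Lemma norm_cvg_cst {I : directedType} {X Y : normedModType R[i]}
    (T_ : I -> X -> Y) (T : X -> Y) : (forall i, T_ i = T) -> norm_cvg T_ T.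
Proof.
move=> TT; apply/cvg_tails0 => e e0; case: (dir_inhabited I) => i.
exists i => j _; have h x : nrm x <= 1 -> nrm ((T_ j \- T) x) <= 0.
  by rewrite TT /= subrr nrm0.
by rewrite ger0_norm ?(op_norm_ge0 h)// (le_trans _ (ltW e0))// op_norm_le.
Qed.

Lemma bounded_setP {X : normedModType R[i]} (S : set X) :
  bounded_set S <-> exists M : R, forall x, S x -> nrm x <= M.
Proof.
split=> [[M [Mr hM]]|[M hM]].
  exists (cabs (M + 1)) => x Sx; have := hM (M + 1); rewrite ltrDl ltr01.
  move=> /(_ isT x Sx) /= xM; rewrite -lecR -cabsE -nrmE (le_trans xM)//.
  by rewrite real_ler_norm// realD// real1.
exists M%:C; split; first by apply/complex_realP; exists M.
move=> N MN x Sx /=; rewrite (le_trans _ (ltW MN))//.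
by rewrite ler_nrm hM.
Qed.

Context {A : banachAlgType R}.

(** By bilinearity, uniform convergence on the product of the unit balls implies
    the estimate with nrm a * nrm x, hence uniform convergence on all products
    of bounded sets. *)
Lemma uniform_approximate_morphismP {I : directedType} {X Y : banachModType A}
    (phi_ : I -> X -> Y) : (forall i, bounded_op X Y (phi_ i)) ->
  uniform_approximate_morphism phi_ <->
  forall e : R, 0 < e -> exists i, forall j, (i <= j)%O -> forall a x,
    nrm (phi_ j (bact a x) - bact a (phi_ j x)) <= e * nrm a * nrm x.
Proof.
move=> bphi; split=> [[_ h] e e0|h]; last split=> // S B.
  pose S := [set a : A | nrm a <= 1]; pose B := [set x : X | nrm x <= 1].
  have bS : bounded_set S by apply/bounded_setP; exists 1.
  have bB : bounded_set B by apply/bounded_setP; exists 1.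
  have [|i _ hi] := h S B bS bB [set g : A * X -> Y | forall z,
      (S `*` B) z -> nrm (g z) <= e].
    apply/uniform_nbhs; exists [set z : Y * Y | ball z.1 e%:C z.2]; split.
      have eC : 0 < e%:C by rewrite ltcR.
      exact: (entourage_ball _ (PosNum eC)).
    move=> g /= hg z /hg; rewrite -ball_normE /= sub0r normrN ltr_nrm.
    exact: ltW.
  exists i => j /hi /= {}hi a x.
  have [lj [M M0 hM]] := (bounded_opP _).1 (bphi j).
  have := @bilinear_ball_le _ _ _ _
    (fun a x => phi_ j (bact a x) - bact a (phi_ j x)) _ _ 1 e ltr01.
  rewrite expr1n divr1; apply=> [v c u w|u c v w|u v u1 v1].
  - by rewrite bact_linearl lj bact_linearl scalerBr opprD addrACA.
  - by rewrite bact_linearr !lj bact_linearr scalerBr opprD addrACA.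
  - exact: (hi (u, v)).
move=> /bounded_setP[r hr] /bounded_setP[s hs] W /uniform_nbhs[V [entV VW]].
have := entV; rewrite -entourage_ballE => -[_ /= /gt0_real[e e0 ->] eV].
pose c := (`|r| + 1) * (`|s| + 1).
have c0 : 0 < c by rewrite mulr_gt0// ltr_pwDr.
have [|i hi] := h (e / 2 / c); first by rewrite !divr_gt0.
exists i => // j /= ij; apply: VW => -[a x] [/= /hr ar /hs xs].
apply: eV => /=; rewrite -ball_normE /= sub0r normrN ltr_nrm.
rewrite (le_lt_trans (hi j ij a x))//.
have ac : nrm a * nrm x <= c.
  rewrite ler_pM ?nrm_ge0//.
    by rewrite (le_trans ar)// (le_trans (ler_norm _))// lerDl.
  by rewrite (le_trans xs)// (le_trans (ler_norm _))// lerDl.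
rewrite -mulrA (@le_lt_trans _ _ (e / 2 / c * c))//.
  by rewrite ler_wpM2l// ltW// !divr_gt0.
by rewrite divfK ?gt_eqF// ltr_pdivrMr// mulr_natr mulr2n ltrDl.
Qed.

Lemma nrm_pair_le {X Y : normedModType R[i]} (x : X) (y : Y) (M : R) :
  (nrm (x, y) <= M) = (nrm x <= M) && (nrm y <= M).
Proof.
rewrite -!ler_nrm [X in X <= _](_ : _ = Num.max `|x| `|y|)//.
rewrite !nrmE /Order.max ltcR -fun_if !lecR.
by have := ge_max M (nrm x) (nrm y); rewrite /Order.max.
Qed.

End Nets.

(** * Triviality of Ext and density of coboundaries *)

Section Implications.
Context {R : realType} {A : banachAlgType R}.

(** A lifting s of the identity of P through the augmentation e gives the module
    projection q x = x - s (e x) onto the kernel of e, and f factors through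
    it: h 0 provides a preimage under d 0, on whose choice f does not depend. *)
Lemma projective_Ext_trivial (P X : banachModType A) :
  projective P -> Ext_topology_trivial 1 P X.
Proof.
move=> pP Q f [hf fd]; suff fB : coboundaries Q X 1 f.
  move=> e e0; exists f => //; rewrite (le_lt_trans _ e0)// op_norm_le// => x _.
  by rewrite /= subrr nrm0.
have [t [h [bt bh et th hd]]] := res_admissible _ Q.
pose e := res_aug Q; pose d := @res_d _ _ _ Q.
have {}hd n x : h n (d n x) + d n.+1 (h n.+1 x) = x by exact: hd.
have {}th x : t (e x) + d 0 (h 0 x) = x by exact: th.
have ed x : e (d 0 x) = 0 by exact: res_augd.
have he : module_hom (res_obj Q 0) P e := res_aug_hom _ Q.
have [s hs es] : exists2 s, module_hom P (res_obj Q 0) s & e \o s = id.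
  apply: pP (module_hom_id P); split; first exact: he.
  by exists t => //; apply/funext.
have {}es x : e (s x) = x by rewrite -[LHS]/((e \o s) x) es.
have fd0 x : f (d 1 x) = 0 by rewrite -[LHS]/((f \o d 1) x) fd.
have fker x : d 0 x = 0 -> f x = 0.
  by move=> dx; rewrite -(hd 0 x) dx (lin0 (bh 0).1) add0r fd0.
have lf := hf.1.1; have lh := (bh 0).1; have le := he.1.1; have ls := hs.1.1.
have ld : linear (d 0) := (res_d_hom _ Q 0).1.1.
have dA a x : d 0 (bact a x) = bact a (d 0 x) by exact: (res_d_hom _ Q 0).2.
have dh x : e x = 0 -> d 0 (h 0 x) = x.
  by move=> ex; rewrite -[RHS](th x) ex (lin0 bt.1) add0r.
pose q x := x - s (e x).
have eq0 x : e (q x) = 0 by rewrite (linB le) es subrr.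
have bq : bounded_op (res_obj Q 0) (res_obj Q 0) q.
  apply: bounded_opB; first exact: bounded_op_id.
  exact: bounded_op_comp hs.1 he.1.
exists (f \o (h 0 \o q)).
  split; first exact: bounded_op_comp hf.1 (bounded_op_comp (bh 0) bq).
  move=> a x /=; rewrite -hf.2; apply/eqP; rewrite -subr_eq0 -(linB lf).
  apply/eqP/fker; rewrite (linB ld) dA !dh//.
  by rewrite /q (linB (bact_linearr a)) he.2 hs.2 subrr.
apply/funext => x; rewrite /comp -/d /q ed (lin0 ls) subr0.
by rewrite -[in RHS](hd 0 x) (linD lf) fd0 addr0.
Qed.

(** The first differential of the bar resolution is a cocycle with values in the
    kernel K of e, and d (1 ⊗ k) = k for k in K.  A coboundary g d at distance
    less than 1/2 therefore gives a g close to the identity on K. *)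
Lemma Ext_trivial_projective (P : banachModType A) :
  (forall X : banachModType A, Ext_topology_trivial 1 P X) -> projective P.
Proof.
move=> triv; have [e he e0] := free_counit P.
have ee := free_counit_epi he e0.
pose K := hom_kernel ee.1; pose Q := bar_resolution he e0.
have d0hom : module_hom (res_obj Q 1) (free_module A P) (res_d Q 0).
  exact: (res_d_hom _ Q 0).
have [f bf fE] := kernel_lift ee.1 d0hom.1
  (@bar_resolution_aug_d0 _ _ _ _ he e0).
have cf : cocycles Q K 1 f.
  split.
    by split=> // a x; apply: kernel_inj; rewrite (kernel_val_hom ee.1).2 !fE d0hom.2.
  apply/funext => x /=; apply: kernel_inj; rewrite fE.
  by rewrite (lin0 (kernel_val_linear ee.1)) (res_dd _ Q 0).
have half : 0 < 2^-1 :> R by rewrite invr_gt0.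
have [_ [g hg <-] fg] := triv K Q f cf _ half.
apply: (@near_retraction_projective _ _ _ _ _ ee g) => // [|k].
  exact: free_projective.
have bD : bounded_op (res_obj Q 1) K (fun x => f x - g (res_d Q 0 x)).
  by apply: bounded_opB => //; exact: bounded_op_comp hg.1 d0hom.1.
have /bounded_opP[lD [M M0 hM]] := bD.
have d0k : res_d Q 0 (gen None (kernel_val k)) = kernel_val k.
  by rewrite bar_resolution_d0_gen kernel_val0 (lin0 (@gen_linear _ _ _ _)) subr0.
have fk : f (gen None (kernel_val k)) = k by apply: kernel_inj; rewrite fE.
have := nrm_le_op_norm (gen None (kernel_val k)) lD hM.
rewrite d0k fk nrmC => /le_trans; apply.
rewrite ler_pM ?nrm_ge0// ?(op_norm_ge0 (M := M))//.
- move=> x x1; rewrite (le_trans (hM x))// ler_piMr//.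
- exact: ltW.
- exact: nrm_gen0.
Qed.

Section BilinearOpNorm.
Context {X Y : banachModType A} (f : A * X -> Y).
Hypothesis linl : forall x, linear (fun a => f (a, x)).
Hypothesis linr : forall a, linear (fun x => f (a, x)).

Lemma bilinear_le_op_norm (C : R) :
  (forall a x, nrm (f (a, x)) <= C * nrm a * nrm x) ->
  forall a x, nrm (f (a, x)) <= op_norm f * nrm a * nrm x.
Proof.
move=> hC; have hC1 z : nrm z <= 1 -> nrm (f z) <= `|C|.
  case: z => a x; rewrite nrm_pair_le => /andP[a1 x1].
  rewrite (le_trans (hC a x))// (@le_trans _ _ (`|C| * nrm a * nrm x))//.
    by rewrite !ler_wpM2r ?nrm_ge0// ler_norm.
  by rewrite -mulrA ler_piMr// mulr_ile1 ?nrm_ge0.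
have := @bilinear_ball_le _ _ _ _ (fun a x => f (a, x)) linl linr 1
  (op_norm f) ltr01; rewrite expr1n divr1; apply=> a x a1 x1.
by apply: op_norm_ge hC1 _; rewrite nrm_pair_le a1.
Qed.
End BilinearOpNorm.

Lemma Z1_bounded {X Y : banachModType A} (f : A * X -> Y) : Z1 X Y f ->
  exists2 C : R, 0 <= C &
    forall (a : A) (x : X), nrm (f (a, x)) <= C * nrm a * nrm x.
Proof.
move=> [cf fl fr _]; apply: (@bilinear_bounded _ _ _ _ (fun a x => f (a, x))) => //.
by rewrite [X in continuous X](_ : _ = f)//; apply/funext => -[].
Qed.

Section Delta0.
Context {X Y : banachModType A} (T : X -> Y).
Hypothesis bT : bounded_op X Y T.

Lemma delta0_linearl x : linear (fun a => delta0 T (a, x)).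
Proof.
by move=> c a b; rewrite /delta0 /= !bact_linearl bT.1 scalerBr opprD addrACA.
Qed.

Lemma delta0_linearr a : linear (fun x => delta0 T (a, x)).
Proof.
move=> c x y; rewrite /delta0 /= bT.1 !bact_linearr bT.1.
by rewrite scalerBr opprD addrACA.
Qed.

Lemma delta0_bounded : exists2 C : R, 0 <= C &
  forall (a : A) (x : X), nrm (delta0 T (a, x)) <= C * nrm a * nrm x.
Proof.
have [_ [M M0 hM]] := (bounded_opP _).1 bT.
have [C C0 hC] := bact_bounded X; have [D D0 hD] := bact_bounded Y.
exists (D * M + M * C) => [|a x]; first by rewrite addr_ge0 ?mulr_ge0.
rewrite (le_trans (nrmB _ _))// !mulrDl lerD//=.
  rewrite (le_trans (hD _ _))//.
  have -> : D * M * nrm a * nrm x = D * nrm a * (M * nrm x) by ring.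
  by rewrite ler_wpM2l// mulr_ge0// nrm_ge0.
by rewrite (le_trans (hM _))// -!mulrA ler_wpM2l// mulrA hC.
Qed.
End Delta0.

Lemma norm_cvg_delta0P {I : directedType} {X Y : banachModType A}
    (T_ : I -> X -> Y) (f : A * X -> Y) :
  (forall i, bounded_op X Y (T_ i)) -> Z1 X Y f ->
  norm_cvg (fun i => delta0 (T_ i)) f <->
  forall e : R, 0 < e -> exists i, forall j, (i <= j)%O -> forall a x,
    nrm (delta0 (T_ j) (a, x) - f (a, x)) <= e * nrm a * nrm x.
Proof.
move=> bT Zf; apply: (iff_trans (cvg_tails0 _)).
split=> h e e0; have [i hi] := h e e0; exists i => j /hi {}hi.
  move=> a x; have [C C0 hC] := Z1_bounded Zf; have [_ fl fr _] := Zf.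
  have [D D0 hD] := delta0_bounded (bT j).
  have := @bilinear_le_op_norm _ _ (delta0 (T_ j) \- f) _ _ (D + C).
  move=> /(_ _ _ _ a x) h1; rewrite (le_trans (h1 _ _ _))//.
  - by move=> y; exact: linear_sub (delta0_linearl (bT j) y) (fl y).
  - by move=> b; exact: linear_sub (delta0_linearr (bT j) b) (fr b).
  - by move=> b y; rewrite (le_trans (nrmB _ _))// !mulrDl lerD.
  - by rewrite !ler_wpM2r ?nrm_ge0// (le_trans (ler_norm _) hi).
have h1 z : nrm z <= 1 -> nrm ((delta0 (T_ j) \- f) z) <= e.
  case: z => a x; rewrite nrm_pair_le => /andP[a1 x1].
  have e1 := ltW e0.
  by rewrite (le_trans (hi a x))// -mulrA ler_piMr// mulr_ile1 ?nrm_ge0.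
rewrite ger0_norm; last exact: op_norm_ge0 h1.
by apply: op_norm_le => //; exact: ltW.
Qed.

(** The cocycle is f(a, x) = a ⊗ x - 1 ⊗ ax = q(a ⊗ x), where q u is
    u - 1 ⊗ e(u).  If delta0 T is close to f and g extends T to a morphism, the
    operator g (u - 1 ⊗ e(u)) - q u vanishes at 1 ⊗ x and equals
    delta0 T (a, x) - f(a, x) at a ⊗ x; on the kernel of e it is g - 1. *)
Lemma Z1_approx_projective (P : banachModType A) :
  (forall (X : banachModType A) (f : A * P -> X), Z1 P X f ->
     exists (I : directedType) (T_ : I -> P -> X),
       (forall i, bounded_op P X (T_ i)) /\
       norm_cvg (fun i => delta0 (T_ i)) f) ->
  projective P.
Proof.
move=> happ; have [e he e0] := free_counit P.
have ee := free_counit_epi he e0.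
set F := free_module A P in e he e0 ee.
pose K := hom_kernel ee.1; pose j : K -> F := @kernel_val _ _ _ _ _ ee.1.
have le : linear e := he.1.1.
have bq : bounded_op F F (fun x => x - gen None (e x)).
  apply: bounded_opB; first exact: bounded_op_id.
  exact: bounded_op_comp bounded_gen he.1.
have [|q bq' jq] := kernel_lift ee.1 bq.
  by move=> x; rewrite (linB le) e0 subrr.
pose f (z : A * P) : K := q (gen (Some z.1) z.2).
have jf a x : j (f (a, x)) = gen (Some a) x - gen None (bact a x).
  by rewrite /j jq -bact_gen0 he.2 e0.
have ji : injective j by exact: kernel_inj.
have jA a k : j (bact a k) = bact a (j k) by exact: (kernel_val_hom ee.1).2.
have lj : linear j := kernel_val_linear ee.1.
have fl x : linear (fun a => f (a, x)).
  by move=> c a b; rewrite /f /= gen_linearl bq'.1.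
have fr a : linear (fun x => f (a, x)).
  by move=> c x y; rewrite /f /= gen_linear bq'.1.
have [_ [C C0 hC]] := (bounded_opP _).1 bq'.
have fC a x : nrm (f (a, x)) <= C * nrm a * nrm x.
  by rewrite (le_trans (hC _))// -mulrA ler_wpM2l// nrm_gen1.
have Zf : Z1 P K f.
  split=> // [|a b x].
    have := @bounded_bilinear_continuous _ _ _ _ (fun a x => f (a, x)) fl fr C fC.
    by rewrite [X in continuous X](_ : _ = f)//; apply/funext => -[].
  apply: ji; rewrite (linD lj) (linB lj) jA !jf (linB (bact_linearr a)).
  rewrite bact_gen bact_gen0 bactA (lin0 lj).
  exact: sub_sub_add_sub.
have [I [T_ [bT]]] := happ K f Zf.
move=> /(norm_cvg_delta0P bT Zf) /(_ 2^-1); rewrite invr_gt0 ltr0n.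
move=> /(_ isT)[i /(_ i (lexx i)) hi].
have [g hg g0] := free_hom_lift (bT i).
have lg : linear g := hg.1.1.
apply: (@near_retraction_projective _ _ _ _ _ ee g) => // [|k].
  exact: free_projective.
have half : 0 <= 2^-1 :> R by rewrite invr_ge0.
have lT := (bT i).1.
have [|x|a|x|a x|S [lS hS S0 S1]] := @free_lift R A P K (fun=> 0)
    (fun a x => delta0 (T_ i) (a, x) - f (a, x)) 2^-1 half.
- by move=> c x y; rewrite scaler0 addr0.
- exact: linear_sub (delta0_linearl (bT i) x) (fl x).
- exact: linear_sub (delta0_linearr (bT i) a) (fr a).
- by rewrite nrm0 mulr_ge0// nrm_ge0.
- by rewrite mulrA.
have SE : S =1 (fun u => g (u - gen None (e u)) - q u).
  apply: free_op_uniq => [||[a|] x].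
  - by apply/bounded_opP; split=> //; exists 2^-1.
  - by apply: bounded_opB => //; exact: (bounded_op_comp hg.1 bq).
  - rewrite S1 /delta0 /= -bact_gen0 he.2 e0 (linB lg) hg.2 !g0 /f /=.
    by rewrite bact_gen0.
  - rewrite S0 e0 subrr (lin0 lg) sub0r; apply/esym/eqP.
    rewrite oppr_eq0; apply/eqP/ji.
    by rewrite /j jq e0 subrr (lin0 (kernel_val_linear ee.1)).
have qk : q (kernel_val k) = k.
  by apply: kernel_inj; rewrite jq kernel_val0 (lin0 (@gen_linear _ _ _ _)) subr0.
have := hS (kernel_val k); rewrite SE kernel_val0 (lin0 (@gen_linear _ _ _ _)).
by rewrite subr0 qk.
Qed.

End Implications.

(** * Approximate liftings *)

Section Lifting.
Context {R : realType} {A : banachAlgType R}.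

Lemma projective_dense_lift (P : banachModType A) : projective P ->
  forall (X Y : banachModType A) (sigma : X -> Y) (phi : P -> Y),
    admissible_epi sigma -> module_hom P Y phi ->
    exists (I : directedType) (phi_ : I -> P -> X),
      (forall i, module_hom P X (phi_ i)) /\
      norm_cvg (fun i => sigma \o phi_ i) phi.
Proof.
move=> pP X Y sigma phi es hphi; have [psi hpsi spsi] := pP _ _ _ _ es hphi.
exists nat_directed, (fun=> psi); split=> //.
exact: norm_cvg_cst.
Qed.

(** The bounded linear section t of sigma corrects the error
    phi - sigma phi_i, at the price of a small defect from being a morphism. *)
Lemma dense_lift_approximate (P X Y : banachModType A) (sigma : X -> Y)
    (phi : P -> Y) (I : directedType) (phi_ : I -> P -> X) :
  admissible_epi sigma -> module_hom P Y phi ->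
  (forall i, module_hom P X (phi_ i)) ->
  norm_cvg (fun i => sigma \o phi_ i) phi ->
  exists psi_ : I -> P -> X, uniform_approximate_morphism psi_ /\
    (forall i, sigma \o psi_ i = phi).
Proof.
move=> [hs [t bt st]] hphi hphi_ cphi.
have {}st y : sigma (t y) = y by rewrite -[LHS]/((sigma \o t) y) st.
have bsphi i := bounded_op_comp hs.1 (hphi_ i).1.
pose r i x := phi x - sigma (phi_ i x).
have br i : bounded_op P Y (r i) by apply: bounded_opB hphi.1 (bsphi i).
have rA i a x : r i (bact a x) = bact a (r i x).
  by rewrite /r hphi.2 (hphi_ i).2 hs.2 (linB (bact_linearr a)).
have bpsi i : bounded_op P X (fun x => phi_ i x + t (r i x)).
  by apply: bounded_opD (hphi_ i).1 _; exact: bounded_op_comp bt (br i).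
exists (fun i x => phi_ i x + t (r i x)); split; last first.
  move=> i; apply/funext => x /=.
  by rewrite (linD hs.1.1) st /r addrC subrK.
apply/uniform_approximate_morphismP => // e e0.
have [_ [M M0 hM]] := (bounded_opP _).1 bt.
have [C C0 hC] := bact_bounded X; have [D D0 hD] := bact_bounded Y.
pose c := M * D + C * M + 1.
have c0 : 0 < c by rewrite ltr_wpDl// addr_ge0 ?mulr_ge0.
have [i hi] := (norm_cvgP bsphi hphi.1).1 cphi (e / c) (divr_gt0 e0 c0).
exists i => j /hi {}hi a x.
have rj y : nrm (r j y) <= e / c * nrm y by rewrite /r nrmC; exact: hi.
rewrite (linD (bact_linearr a)) (hphi_ j).2 opprD addrACA subrr add0r rA.
rewrite (le_trans (nrmB _ _))//.
apply: (@le_trans _ _ ((M * D + C * M) * (nrm a * (e / c * nrm x)))).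
  rewrite mulrDl; apply: lerD.
    rewrite (le_trans (hM _))//.
    have -> : M * D * (nrm a * (e / c * nrm x)) =
      M * (D * nrm a * (e / c * nrm x)) by ring.
    rewrite ler_wpM2l// (le_trans (hD _ _))//.
    by rewrite ler_wpM2l ?mulr_ge0 ?nrm_ge0.
  rewrite (le_trans (hC _ _))//.
  have -> : C * M * (nrm a * (e / c * nrm x)) =
    C * nrm a * (M * (e / c * nrm x)) by ring.
  rewrite ler_wpM2l ?mulr_ge0 ?nrm_ge0// (le_trans (hM _))//.
  by rewrite ler_wpM2l.
have -> : (M * D + C * M) * (nrm a * (e / c * nrm x)) =
  (M * D + C * M) / c * (e * nrm a * nrm x) by ring.
rewrite ler_piMl ?mulr_ge0 ?nrm_ge0 ?(ltW e0)//.
by rewrite ler_pdivrMr// mul1r lerDl.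
Qed.

(** The cocycle f(a, p u) on F is a coboundary delta0 S.  Then delta0 (S rho_i)
    differs from f by f(a, p rho_i x - x) and by the value of S at the defect
    of rho_i from being a morphism. *)
Lemma approximate_section_Z1 (P F : banachModType A) (p : F -> P)
    (I : directedType) (rho_ : I -> P -> F) :
  projective F -> admissible_epi p -> uniform_approximate_morphism rho_ ->
  norm_cvg (fun i => p \o rho_ i) id ->
  forall (X : banachModType A) (f : A * P -> X), Z1 P X f ->
    exists (I : directedType) (T_ : I -> P -> X),
      (forall i, bounded_op P X (T_ i)) /\
      norm_cvg (fun i => delta0 (T_ i)) f.
Proof.
move=> pF ep urho crho X f Zf; have brho := urho.1; have hp := ep.1.
have [C C0 hC] := Z1_bounded Zf; have [_ fl fr fZ] := Zf.
have [_ [N N0 hN]] := (bounded_opP _).1 hp.1.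
pose g (z : A * F) : X := f (z.1, p z.2).
have gl x : linear (fun a => g (a, x)).
  by move=> c a b; rewrite /g /= fl.
have gr a : linear (fun x => g (a, x)).
  by move=> c x y; rewrite /g /= hp.1.1 fr.
have Zg : Z1 F X g.
  split=> // [|a b x]; last by rewrite /g /= hp.2 fZ.
  have := @bounded_bilinear_continuous _ _ _ _ (fun a x => g (a, x)) gl gr
    (C * N); rewrite [X in continuous X](_ : _ = g); last by apply/funext => -[].
  apply=> a x; rewrite (le_trans (hC _ _))//.
  have -> : C * N * nrm a * nrm x = C * nrm a * (N * nrm x) by ring.
  by rewrite ler_wpM2l// mulr_ge0 ?nrm_ge0.
have [S bS dS] := projective_Z1 pF Zg; have lS := bS.1.
have {}dS a u : bact a (S u) - S (bact a u) = f (a, p u).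
  by rewrite -[RHS]/(g (a, u)) -dS.
have bT i : bounded_op P X (S \o rho_ i) by exact: bounded_op_comp bS (brho i).
exists I, (fun i => S \o rho_ i); split=> //.
apply/norm_cvg_delta0P => // e e0.
have [_ [M M0 hM]] := (bounded_opP _).1 bS.
pose c := C + M + 1; have c0 : 0 < c by rewrite ltr_wpDl// addr_ge0.
have d0 := divr_gt0 e0 c0.
have bprho i := bounded_op_comp hp.1 (brho i).
have [i1 h1] := (norm_cvgP bprho (@bounded_op_id _ P)).1 crho _ d0.
have [i2 h2] := (uniform_approximate_morphismP brho).1 urho _ d0.
have [i [i1i i2i]] := dir_directed I i1 i2; exists i => j ij a x.
have {}h1 := h1 j (le_trans i1i ij) x.
have {}h2 := h2 j (le_trans i2i ij) a x.
rewrite /delta0 /=; have -> : bact a (S (rho_ j x)) - S (rho_ j (bact a x))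
    - f (a, x) = f (a, p (rho_ j x) - x) -
      S (rho_ j (bact a x) - bact a (rho_ j x)).
  rewrite (linB (fr a)) -dS (linB lS) opprB.
  by rewrite [RHS]addrAC [X in _ = X + _]addrA subrK.
rewrite (le_trans (nrmB _ _))//.
apply: (@le_trans _ _ ((C + M) * (e / c * nrm a * nrm x))).
  rewrite mulrDl; apply: lerD; last first.
    by rewrite (le_trans (hM _))// ler_wpM2l.
  rewrite (le_trans (hC _ _))//.
  have -> : C * (e / c * nrm a * nrm x) = C * nrm a * (e / c * nrm x) by ring.
  by rewrite ler_wpM2l ?mulr_ge0 ?nrm_ge0.
have -> : (C + M) * (e / c * nrm a * nrm x) =
  (C + M) / c * (e * nrm a * nrm x) by ring.
rewrite ler_piMl ?mulr_ge0 ?nrm_ge0 ?(ltW e0)//.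
by rewrite ler_pdivrMr// mul1r lerDl.
Qed.
End Lifting.

Theorem theorem2p6 (R : realType) (A : banachAlgType R) (P : banachModType A) :
  [<->
   (* (i) *)
   projective P;
   (* (ii) *)
   forall X : banachModType A, Ext_topology_trivial 1 P X;
   (* (iii) *)
   forall (X Y : banachModType A) (sigma : X -> Y) (phi : P -> Y),
     admissible_epi sigma -> module_hom P Y phi ->
     exists (I : directedType) (phi_ : I -> P -> X),
       (forall i, module_hom P X (phi_ i)) /\
       norm_cvg (fun i => sigma \o phi_ i) phi;
   (* (iv) *)
   forall (X Y : banachModType A) (sigma : X -> Y) (phi : P -> Y),
     admissible_epi sigma -> module_hom P Y phi ->
     exists (I : directedType) (psi_ : I -> P -> X),
       uniform_approximate_morphism psi_ /\
       (forall i, sigma \o psi_ i = phi);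
   (* (v) *)
   forall (X Y : banachModType A) (sigma : X -> Y) (phi : P -> Y),
     admissible_epi sigma -> module_hom P Y phi ->
     exists (I : directedType) (psi_ : I -> P -> X),
       uniform_approximate_morphism psi_ /\
       norm_cvg (fun i => sigma \o psi_ i) phi;
   (* (vi) *)
   exists (F : banachModType A) (pi : F -> P)
     (I : directedType) (rho_ : I -> P -> F),
     [/\ projective F, admissible_epi pi,
         uniform_approximate_morphism rho_ &
         norm_cvg (fun i => pi \o rho_ i) id];
   (* (vii) *)
   forall (X : banachModType A) (f : A * P -> X), Z1 P X f ->
     exists (I : directedType) (T_ : I -> P -> X),
       (forall i, bounded_op P X (T_ i)) /\
       norm_cvg (fun i => delta0 (T_ i)) f].
Proof.
tfae.
- by move=> pP X; exact: projective_Ext_trivial.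
- by move=> /Ext_trivial_projective; exact: projective_dense_lift.
- move=> dl X Y sigma phi es hphi.
  have [I [phi_ [hphi_ cphi]]] := dl X Y sigma phi es hphi.
  by exists I; exact: dense_lift_approximate cphi.
- move=> al X Y sigma phi es hphi.
  have [I [psi_ [upsi spsi]]] := al X Y sigma phi es hphi.
  by exists I, psi_; split=> //; exact: norm_cvg_cst.
- move=> al; have [e he e0] := free_counit P.
  have ee := free_counit_epi he e0.
  have [I [rho_ [urho crho]]] := al _ _ _ _ ee (@module_hom_id _ _ P).
  exists (free_module A P), e, I, rho_; split=> //.
  exact: free_projective.
- move=> [F [p [I [rho_ [pF ep urho crho]]]]].
  exact: approximate_section_Z1 crho.
- exact: Z1_approx_projective.
Qed.
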